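(* Let $G$ be a crystallographic group with lattice $N$ and point group $D$. Let $\sigma_k\to\sigma$ be a generic sequence of irreducible representations over a convergent sequence $\chi_k\to\chi$ in $\widehat{N}$, where the $\chi_k$ have a shared stabilizer $G_*$. Then there is a nonempty subset $\{[\rho_j]\}\subseteq\widehat{G}_\chi^{(\chi)}$ such that the sequence $\{[\mathrm{ind}_{G_*}^G\sigma_k]\}\subseteq\widehat{G}$ converges in $\widehat{G}$ to every element of the set $\{[\mathrm{ind}_{G_\chi}^G\rho_j]\}\subseteq\widehat{G}$. Moreover, if $[\mathrm{ind}_{G_*}^G\sigma_k]\to[\pi]$ for some $[\pi]\in\widehat{G}$, then $\pi\simeq\mathrm{ind}_{G_\chi}^G\rho$ for some $[\rho]\in\widehat{G}_\chi^{(\chi)}$.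
   Context: A crystallographic group of dimension $r$ is a discrete group $G$ fitting into a short exact sequence $1\to N\to G\xrightarrow{q}D\to1$ with $N\cong\mathbb{Z}^r$ maximally abelian in $G$ (the lattice) and $D$ finite (the point group). Fix a section $\gamma:D\to G$ of $q$ with $\gamma(1_D)=1_G$, and set $\nu(h,k)=\gamma(hk)^{-1}\gamma(h)\gamma(k)\in N$ for $h,k\in D$. $G$ acts on $N$ by $g\cdot n=gng^{-1}$ and on $\widehat{N}\cong\mathbb{T}^r$ by $(g\cdot\chi)(n)=\chi(g^{-1}\cdot n)$. The stabilizer of $\chi$ is $G_\chi=\{g\in G: g\cdot\chi=\chi\}\supseteq N$, and $D_\chi=G_\chi/N$. If $\chi_k\to\chi$ and all $\chi_k$ have the same stabilizer $G_*$, then $G_*\le G_\chi$; put $D_*=G_*/N$. All representations are unitary; $\simeq$ is unitary equivalence. $\widehat{G}$ is the set of equivalence classes of irreducible representations of $G$, with the topology transported from the spectrum $\widehat{C^*(G)}$ of the full group $C^*$-algebra by the canonical bijection; the topology of the spectrum is the inverse image of the Jacobson (hull-kernel) topology on the primitive ideal space under $[\pi]\mapsto\ker\pi$. $\mathrm{ind}$ denotes the usual induced unitary representation. For a subgroup $N\le G_\bullet\le G_\chi$, $\widehat{G}_\bullet^{(\chi)}$ is the set of classes of irreducible representations $\sigma$ of $G_\bullet$ with $\sigma|_N=\chi^{\oplus m}$ for some $m\in\mathbb{Z}_{>0}$; in particular $\widehat{G}_\chi^{(\chi)}$ is the case $G_\bullet=G_\chi$. A unitary 2-cocycle on a finite group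 $H$ is $\omega:H\times H\to\mathbb{T}$ with $\omega(xy,z)\omega(x,y)=\omega(x,yz)\omega(y,z)$ and $\omega(e,h)=1=\omega(h,e)$. For a normalized function $\lambda:H\to\mathbb{T}$ (i.e. $\lambda(e)=1$), $\tau_\lambda(x,y)=\lambda(xy)[\lambda(x)\lambda(y)]^{-1}$. An $\omega$-representation of $H$ is a map $\pi^P:H\to\mathsf{U}(\mathcal{V})$ with $\pi^P(xy)=\omega(x,y)\pi^P(x)\pi^P(y)$. For a character $\chi$ with $N\le G_*\le G_\chi$, let $\omega_\chi=\overline{\chi}\circ\nu$ (a 2-cocycle on $D_*$) and $\chi^*(x)=\chi(\gamma(q(x))^{-1}x)$ for $x\in G_*$. Generic sequence over $\chi_k\to\chi$: let $\chi_k\to\chi$ in $\widehat{N}$ ($k\ge0$), all $\chi_k$ having the same stabilizer $G_*$, with $\omega_k=\overline{\chi_k}\circ\nu$ and $\omega=\overline{\chi}\circ\nu$ all cohomologous over $D_*$ (which can be arranged by passing to a subsequence). Choose normalized functions $\lambda_k:D_*\to\mathbb{T}$, with $\lambda_0=1$, such that $\omega_k=\omega_0\cdot\tau_{\lambda_k}$ and (after passing to a subsequence) $\lambda_k\to\lambda$ pointwise on $D_*$, so that $\omega=\omega_0\cdot\tau_\lambda$. Let $\Phi^P$ be an irreducible $\omega_0$-representation of $D_*$ on a fixed Hilbert space $\mathcal{H}_n$ of finite dimension $n$. Then $\sigma_k=\chi_k^*\cdot\big((\Phi^P\cdot\lambda_k)\circ q\big)$ and $\sigma=\chi^*\cdot\big((\Phi^P\cdot\lambda)\circ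 q\big)$ are irreducible (ordinary) representations of $G_*$ on $\mathcal{H}_n$ with $\sigma_k|_N=\chi_k^{\oplus n}$, $\sigma|_N=\chi^{\oplus n}$, and $\sigma_k\to\sigma$ pointwise on $G_*$ in $\mathsf{U}(\mathcal{H}_n)$. Such a sequence $\sigma_k\to\sigma$ is called a generic sequence of irreducible representations over $\chi_k\to\chi$. *)

(* Defs.v *)
From HB Require Import structures.
From mathcomp Require Import all_boot all_order all_algebra all_fingroup.
From mathcomp Require Import sesquilinear complex finmap.
From mathcomp Require Import all_classical all_reals.
From mathcomp Require Import topology normedtype sequences realfun lra.

Set Implicit Arguments.
Unset Strict Implicit.
Unset Printing Implicit Defensive.

Import Order.TTheory GRing.Theory Num.Theory numFieldNormedType.Exports.
Local Open Scope classical_set_scope.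
Local Open Scope ring_scope.

Section HilbertNorm.
Variables (R : realType) (V : lmodType R[i]) (form : {dot V for Num.conj}).

Definition dnorm (v : V) : R := Num.sqrt (complex.Re (form v v)).

Definition dcvg (u : nat -> V) (l : V) : Prop :=
  dnorm (u k - l) @[k --> \oo] --> (0 : R).

Definition dcauchy (u : nat -> V) : Prop :=
  forall e : R, 0 < e -> exists M : nat, forall j k : nat,
    (M <= j)%N -> (M <= k)%N -> dnorm (u j - u k) < e.

Lemma dnorm_ge0 v : 0 <= dnorm v. Proof. exact: sqrtr_ge0. Qed.

Lemma Re_dot_ge0 v : 0 <= complex.Re (form v v).
Proof.
have : 0 <= form v v by exact: sesquilinear.dnorm_ge0.
by rewrite lecE/= => /andP[].
Qed.

Lemma dnorm_sqr v : dnorm v ^+ 2 = complex.Re (form v v).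
Proof. by rewrite sqr_sqrtr// Re_dot_ge0. Qed.

Lemma dnorm_eq0 v : dnorm v = 0 -> v = 0.
Proof.
move=> /(congr1 (fun x => x ^+ 2)); rewrite expr0n/= dnorm_sqr => v0.
apply/eqP; rewrite -(sesquilinear.dnorm_eq0 form) eq_complex v0/= eqxx/=.
have : 0 <= form v v by exact: sesquilinear.dnorm_ge0.
by rewrite lecE/= => /andP[].
Qed.

Lemma dnormBC u v : dnorm (u - v) = dnorm (v - u).
Proof.
by rewrite -opprB /dnorm linearNl linearNr opprK.
Qed.

Lemma dnorm_parallelogram u v :
  dnorm (u + v) ^+ 2 <= 2 * dnorm u ^+ 2 + 2 * dnorm v ^+ 2.
Proof.
have := Re_dot_ge0 (u - v); rewrite !dnorm_sqr.
rewrite sesquilinear.dnormB sesquilinear.dnormD.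
by case: (form u u) (form v v) (form u v) => [a b] [c d] [e f]/=; lra.
Qed.

Lemma dcvg_unique (u : nat -> V) (l l' : V) : dcvg u l -> dcvg u l' -> l = l'.
Proof.
move=> ul ul'; apply/eqP; rewrite -subr_eq0; apply/eqP/dnorm_eq0.
apply/eqP; rewrite -sqrf_eq0 eq_le sqr_ge0 andbT.
pose w k := 2 * dnorm (u k - l) ^+ 2 + 2 * dnorm (u k - l') ^+ 2.
have w0 : w k @[k --> \oo] --> (0 : R).
  rewrite (_ : 0 = 2 * (0 * 0) + 2 * (0 * 0)); last by rewrite !mulr0 addr0.
  by apply: cvgD; (apply: cvgM; first exact: cvg_cst); apply: cvgM.
apply: (cvgr_to_ge w0); apply: nearW => k.
have := dnorm_parallelogram (l - u k) (u k - l').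
by rewrite addrA subrK (dnormBC l (u k)).
Qed.

End HilbertNorm.

(* The inner product is linear in its first argument. *)
Record hilbert (R : realType) := Hilbert {
  hilbert_sort :> lmodType R[i];
  hdot : {dot hilbert_sort for Num.conj};
  hilbert_complete : forall u : nat -> hilbert_sort,
    dcauchy hdot u -> exists l, dcvg hdot u l }.

Arguments hdot {R} _.

Section Operators.
Variable R : realType.

Definition hnorm (H : hilbert R) (v : H) : R := dnorm (hdot H) v.

Definition hcvg (H : hilbert R) (u : nat -> H) (l : H) : Prop :=
  dcvg (hdot H) u l.

Definition unitary_op (H1 H2 : hilbert R) (T : H1 -> H2) : Prop :=
  [/\ linear T,
      forall u v, hdot H2 (T u) (T v) = hdot H1 u v
    & forall w, exists v, T v = w].

Definition closed_subspace (H : hilbert R) (W : set H) : Prop :=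
  [/\ W 0,
      forall (a : R[i]) u v, W u -> W v -> W (a *: u + v)
    & forall (u : nat -> H) (l : H),
        (forall k, W (u k)) -> hcvg u l -> W l].

Definition irreducible (X : Type) (K : set X) (H : hilbert R)
    (act : X -> H -> H) : Prop :=
  (exists v : H, v != 0) /\
  forall W : set H, closed_subspace W ->
    (forall x v, K x -> W v -> W (act x v)) -> W = [set 0] \/ W = setT.

Definition has_dim (H : hilbert R) (m : nat) : Prop :=
  exists e : 'I_m -> H,
    bijective (fun c : 'rV[R[i]]_m => \sum_(i < m) c 0 i *: e i).

End Operators.

(* As for mathcomp's {morphism D >-> rT}, a representation of a subgroup K
   of G is a function on G whose values outside K are irrelevant. *)

Section Subgroups.
Variable G : groupType.

Definition subgroup (K : set G) : Prop :=
  K 1%g /\ forall x y, K x -> K y -> K (x * y^-1)%g.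

Definition lcoset (K : set G) (x : G) : set G := [set (x * k)%g | k in K].

Definition lcosets (K : set G) : set (set G) := range (lcoset K).

Record fisubgroup := FiSubgroup {
  fisubgroup_set :> set G;
  fisubgroupP : subgroup fisubgroup_set;
  fisubgroup_fin : finite_set (lcosets fisubgroup_set) }.

Lemma subgroupV (K : set G) x : subgroup K -> K x -> K x^-1%g.
Proof. by move=> [K1 KD] Kx; rewrite -[X in K X]mul1g; apply: KD. Qed.

Lemma subgroupM (K : set G) x y : subgroup K -> K x -> K y -> K (x * y)%g.
Proof.
move=> sK Kx Ky; rewrite -[y]invgK; apply: sK.2 => //.
exact: subgroupV.
Qed.

End Subgroups.

Record urep (R : realType) (G : groupType) (K : set G) (H : hilbert R) := Urep {
  urep_fun :> G -> H -> H;
  urep_unitary : forall x, K x -> unitary_op (urep_fun x);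
  urepM : forall x y v, K x -> K y ->
    urep_fun (x * y)%g v = urep_fun x (urep_fun y v) }.

Arguments urep {R G} K H.

Definition unitarily_equivalent (R : realType) (G : groupType) (K : set G)
    (H1 H2 : hilbert R) (pi1 : urep K H1) (pi2 : urep K H2) : Prop :=
  exists2 T : H1 -> H2, unitary_op T &
    forall x v, K x -> T (pi1 x v) = pi2 x (T v).

(* Induction from a subgroup K of finite index: the representation space
   consists of the functions f : G -> H with f (x k) = pi(k)^-1 (f x) for k in
   K, with inner product the sum over the cosets x K of <f x, f' x>, and G acts
   by left translation. *)

Section UrepTheory.
Variables (R : realType) (G : groupType) (K : set G) (H : hilbert R).
Variable pi : urep K H.

Lemma urep_linear x : K x -> linear (pi x).
Proof. by case/(urep_unitary pi). Qed.

Lemma urep_dot x u v : K x -> hdot H (pi x u) (pi x v) = hdot H u v.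
Proof. by case/(urep_unitary pi). Qed.

Lemma urep0 x : K x -> pi x 0 = 0.
Proof.
move=> Kx; have := urep_linear Kx (-1) 0 0.
by rewrite !scaleN1r oppr0 addr0 addNr.
Qed.

Lemma urepB x u v : K x -> pi x (u - v) = pi x u - pi x v.
Proof.
move=> Kx; have := urep_linear Kx (-1) v u.
by rewrite !scaleN1r => piD; rewrite addrC piD addrC.
Qed.

Lemma urep_norm x u : K x -> hnorm (pi x u) = hnorm u.
Proof. by move=> Kx; rewrite /hnorm /dnorm urep_dot. Qed.

End UrepTheory.

Section InducedSpace.
Variables (R : realType) (G : groupType) (K : fisubgroup G) (H : hilbert R).
Variable pi : urep K H.

Definition equivariant : pred (G -> H) := fun f =>
  `[< forall x k, fisubgroup_set K k -> f (x * k)%g = pi k^-1%g (f x) >].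

Lemma equivariant_submod : subsemimod_closed equivariant.
Proof.
have KV k : fisubgroup_set K k -> fisubgroup_set K k^-1%g.
  by apply: subgroupV; apply: fisubgroupP.
split; [split|].
- by apply/asboolP => x k /KV Kk; rewrite urep0.
- move=> f g /asboolP fE /asboolP gE; apply/asboolP => x k Kk.
  have := urep_linear pi (KV _ Kk) 1 (f x) (g x).
  rewrite !scale1r => piD.
  by rewrite -[LHS]/(f (x * k)%g + g (x * k)%g) fE// gE.
- move=> a f /asboolP fE; apply/asboolP => x k Kk.
  have := urep_linear pi (KV _ Kk) a (f x) 0.
  rewrite !addr0 urep0 ?addr0; last exact: KV.
  by move=> piZ; rewrite -[LHS]/(a *: f (x * k)%g) fE.
Qed.

HB.instance Definition _ :=
  GRing.isSubmodClosed.Build R[i] (G -> H) equivariant equivariant_submod.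

Record induced := Induced {
  induced_fun :> G -> H;
  inducedP : induced_fun \in equivariant }.

HB.instance Definition _ := [isSub for induced_fun].
HB.instance Definition _ := [Choice of induced by <:].
HB.instance Definition _ := [SubChoice_isSubLmodule of induced by <:].

Definition induced_dot (f g : induced) : R[i] :=
  \sum_(A \in lcosets K) hdot H (f (xget 1%g A)) (g (xget 1%g A)).


Lemma mem_lcosets x : lcosets K (lcoset K x).
Proof. by exists x. Qed.

Lemma lcoset_repr (A : set G) : lcosets K A -> lcoset K (xget 1%g A) = A.
Proof.
move=> [x _ <-]; have sK := fisubgroupP K.
have : lcoset K x (xget 1%g (lcoset K x)).
  by apply: (xgetPex 1%g); exists x; exists 1%g; [exact: sK.1|rewrite mulg1].
case=> k Kk; move: (xget _ _) => y <-.
apply/seteqP; split => z [k' Kk' <-].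
  by exists (k * k')%g; [exact: subgroupM|rewrite mulgA].
exists (k^-1 * k')%g; first by apply: subgroupM => //; exact: subgroupV.
by rewrite mulgA mulgK.
Qed.

Lemma induced_eqv (f : induced) x k :
  fisubgroup_set K k -> f (x * k)%g = pi k^-1%g (f x).
Proof. by move=> Kk; have /asboolP := inducedP f; apply. Qed.

Lemma induced_val0 x : (0 : induced) x = 0. Proof. by []. Qed.

Lemma induced_valB (f g : induced) x : (f - g) x = f x - g x.
Proof. by []. Qed.

Lemma induced_dotE f g : induced_dot f g =
  \sum_(A <- fset_set (lcosets K)) hdot H (f (xget 1%g A)) (g (xget 1%g A)).
Proof. by rewrite /induced_dot fsbig_finite //; exact: fisubgroup_fin. Qed.

Lemma induced_dotl_zmod g : zmod_morphism (induced_dot^~ g).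
Proof.
move=> f f'; rewrite !induced_dotE -sumrB; apply: eq_bigr => A _.
by rewrite induced_valB linearBl.
Qed.

Lemma induced_dotr_zmod f : zmod_morphism (induced_dot f).
Proof.
move=> g g'; rewrite !induced_dotE -sumrB; apply: eq_bigr => A _.
by rewrite induced_valB linearBr.
Qed.

Lemma induced_dotl_scal g : scalable_for *%R (induced_dot^~ g).
Proof.
move=> a f; rewrite !induced_dotE mulr_sumr; apply: eq_bigr => A _.
exact: linearZl_LR.
Qed.

Lemma induced_dotr_scal f : scalable_for (Num.conj \; *%R) (induced_dot f).
Proof.
move=> a g; rewrite !induced_dotE /comp/= mulr_sumr; apply: eq_bigr => A _.
exact: linearZr_LR.
Qed.

HB.instance Definition _ := isBilinear.Build R[i] induced induced R[i]
  *%R (Num.conj \; *%R) induced_dot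
  induced_dotl_zmod induced_dotr_zmod induced_dotl_scal induced_dotr_scal.

Lemma induced_dot_herm f g :
  induced_dot f g = (-1) ^+ false * Num.conj (induced_dot g f).
Proof.
rewrite expr0 mul1r !induced_dotE rmorph_sum; apply: eq_bigr => A _.
by rewrite [LHS](@hermitian_subproof _ _ _ _ (hdot H)) expr0 mul1r.
Qed.

HB.instance Definition _ := isHermitianSesquilinear.Build R[i] induced
  false Num.conj induced_dot induced_dot_herm.

Lemma coset_decomp x : exists2 k, fisubgroup_set K k &
  x = (xget 1%g (lcoset K x) * k)%g.
Proof.
have : lcoset K (xget 1%g (lcoset K x)) x.
  rewrite lcoset_repr; last exact: mem_lcosets.
  by exists 1%g; [exact: (fisubgroupP K).1|rewrite mulg1].
by case=> k Kk kx; exists k.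
Qed.

Lemma induced_dot_gt0 f : f != 0 -> 0 < induced_dot f f.
Proof.
move=> f0; rewrite induced_dotE lt_def.
have ge0 A : true -> 0 <= hdot H (f (xget 1%g A)) (f (xget 1%g A)).
  by move=> _; exact: sesquilinear.dnorm_ge0.
rewrite sumr_ge0 ?andbT; last by move=> A _; exact: ge0.
apply: contraNN f0; rewrite psumr_eq0 => [|A _]; last exact: ge0.
move=> /allP f0; apply/eqP/val_inj/funext => x.
have [k Kk ->] := coset_decomp x.
have KVk : fisubgroup_set K k^-1%g.
  by apply: subgroupV => //; exact: fisubgroupP.
rewrite [LHS]induced_eqv//.
suff -> : f (xget 1%g (lcoset K x)) = 0 by rewrite urep0.
have : lcoset K x \in fset_set (lcosets K).
  by rewrite in_fset_set ?inE//; [exact: mem_lcosets|exact: fisubgroup_fin].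
by move=> /f0; rewrite sesquilinear.dnorm_eq0 => /eqP.
Qed.

HB.instance Definition _ := isDotProduct.Build R[i] induced induced_dot
  induced_dot_gt0.

Lemma induced_dnorm_sqr (f : induced) : dnorm induced_dot f ^+ 2 =
  \sum_(A <- fset_set (lcosets K)) hnorm (f (xget 1%g A)) ^+ 2.
Proof.
rewrite dnorm_sqr [form in complex.Re form]induced_dotE.
rewrite (big_morph (@complex.Re R) (id1 := 0) (op1 := +%R))//; last first.
  by case=> a b [].
by apply: eq_bigr => A _; rewrite /hnorm dnorm_sqr.
Qed.

Lemma induced_dnorm_ge (f : induced) x : hnorm (f x) <= dnorm induced_dot f.
Proof.
have [k Kk ->] := coset_decomp x.
rewrite induced_eqv// urep_norm; last first.
  by apply: subgroupV => //; exact: fisubgroupP.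
rewrite -(@ler_pXn2r _ 2)// ?nnegrE; [|exact: dnorm_ge0..].
rewrite induced_dnorm_sqr (bigD1_seq (lcoset K x))//=; last 2 first.
- by rewrite in_fset_set ?inE//; [exact: mem_lcosets|exact: fisubgroup_fin].
- exact: finmap.fset_uniq.
by rewrite lerDl sumr_ge0// => A _; exact: sqr_ge0.
Qed.

Lemma induced_complete (u : nat -> induced) :
  dcauchy induced_dot u -> exists l, dcvg induced_dot u l.
Proof.
move=> uC.
have /choice[F uF] x : exists l, hcvg (fun k => u k x) l.
  apply: hilbert_complete => e /uC[M uM]; exists M => j k Mj Mk.
  by apply: le_lt_trans (uM _ _ Mj Mk); exact: (induced_dnorm_ge (u j - u k)).
have FE : F \in equivariant.
  apply/asboolP => x k Kk.
  have KVk : fisubgroup_set K k^-1%g.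
    by apply: subgroupV => //; exact: fisubgroupP.
  apply: dcvg_unique (uF (x * k)%g) _; rewrite /dcvg.
  under eq_fun do rewrite induced_eqv// -urepB// -/(hnorm _) urep_norm//.
  exact: uF.
exists (Induced FE); rewrite /dcvg.
have sq0 : \sum_(A <- fset_set (lcosets K))
    hnorm (u k (xget 1%g A) - F (xget 1%g A)) ^+ 2 @[k --> \oo] --> (0 : R).
  rewrite [X in _ --> X](_ : _ = \sum_(A <- fset_set (lcosets K)) (0 : R));
    last by rewrite big1.
  apply: cvg_big => [|A _]; first exact: add_continuous.
  rewrite -[0](mulr0 0).
  by apply: cvgM; exact: uF.
rewrite -[X in _ --> X]sqrtr0.
have := cvg_comp _ (@Num.sqrt R) sq0 (@sqrt_continuous R 0).
apply: cvg_trans; apply: near_eq_cvg; apply: nearW => k /=.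
have := induced_dnorm_sqr (u k - Induced FE) => /= <-.
by rewrite sqrtr_sqr ger0_norm// dnorm_ge0.
Qed.

Definition induced_hilbert : hilbert R := Hilbert induced_complete.

Lemma translate_equivariant g (f : induced) :
  (fun x => f (g^-1 * x)%g) \in equivariant.
Proof. by apply/asboolP => x k Kk /=; rewrite mulgA induced_eqv. Qed.

Definition translate (g : G) (f : induced_hilbert) : induced_hilbert :=
  Induced (translate_equivariant g f).

Lemma induced_dot_repr (f f' : induced) x :
  hdot H (f (xget 1%g (lcoset K x))) (f' (xget 1%g (lcoset K x))) =
  hdot H (f x) (f' x).
Proof.
have [k Kk xE] := coset_decomp x; rewrite [in RHS]xE !induced_eqv//.
by rewrite urep_dot//; apply: subgroupV => //; exact: fisubgroupP.
Qed.

Lemma lcoset_translate g x : lcoset K (g * x)%g = [set (g * y)%g | y in lcoset K x].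
Proof.
apply/seteqP; split => z.
  by case=> k Kk <-; exists (x * k)%g; [exists k|rewrite mulgA].
by case=> _ [k Kk <-] <-; exists k; rewrite ?mulgA.
Qed.

Lemma set_translateVK (g : G) (A : set G) :
  [set (g * y)%g | y in [set (g^-1 * y)%g | y in A]] = A.
Proof.
apply/seteqP; split => [_ [_ [y Ay <-] <-]|y Ay]; first by rewrite mulKVg.
by exists (g^-1 * y)%g; [exists y|rewrite mulKVg].
Qed.

Lemma translate_dot g f f' :
  induced_dot (translate g f) (translate g f') = induced_dot f f'.
Proof.
rewrite {2}/induced_dot (@reindex_fsbig _ _ _ _ _
  (fun A : set G => [set (g^-1 * y)%g | y in A]) (lcosets K)); last first.
  split.
  - by move=> _ [x _ <-]; exists (g^-1 * x)%g => //; exact: lcoset_translate.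
  - move=> A B _ _ /(congr1 (fun A : set G => [set (g * y)%g | y in A])).
    by rewrite !set_translateVK.
  - move=> _ [x _ <-]; exists (lcoset K (g * x)%g); first exact: mem_lcosets.
    by rewrite -lcoset_translate mulKg.
apply: eq_fsbigr => A; rewrite inE => KA.
rewrite -{3 4}(lcoset_repr KA) -lcoset_translate.
by rewrite (induced_dot_repr f f').
Qed.

Lemma translate_unitary g : [set: G] g -> unitary_op (translate g).
Proof.
move=> _; split.
- by move=> a u v; apply: val_inj; apply/funext.
- exact: translate_dot.
- move=> w; exists (translate g^-1%g w); apply: val_inj; apply/funext => x /=.
  by rewrite invgK mulKVg.
Qed.

Lemma translateM g h v : [set: G] g -> [set: G] h ->
  translate (g * h)%g v = translate g (translate h v).
Proof.
move=> _ _; apply: val_inj; apply/funext => x /=.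
by rewrite invMg mulgA.
Qed.

Definition induced_rep : urep [set: G] induced_hilbert :=
  Urep translate_unitary translateM.

End InducedSpace.

Section GroupCstar.
Variables (R : realType) (G : groupType).

(* C[G], as functions of finite support *)
Definition group_algebra : set (G -> R[i]) :=
  [set f | finite_set [set g | f g != 0]].

Definition integrated (H : hilbert R) (pi : urep [set: G] H)
    (f : G -> R[i]) (v : H) : H :=
  \sum_(g \in [set: G]) f g *: pi g v.

Definition rep_norm (H : hilbert R) (pi : urep [set: G] H)
    (f : G -> R[i]) : R :=
  sup [set hnorm (integrated pi f v) | v in [set v | hnorm v <= 1]].

Definition cstar_norm (f : G -> R[i]) : R :=
  sup [set x | exists (H : hilbert R) (pi : urep [set: G] H),
                 x = rep_norm pi f].

Definition cstar_cauchy (u : nat -> G -> R[i]) : Prop :=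
  (forall k, group_algebra (u k)) /\
  forall e : R, 0 < e -> exists M : nat, forall j k : nat,
    (M <= j)%N -> (M <= k)%N -> cstar_norm (u j - u k) < e.

(* C*(G) is the completion of C[G] for cstar_norm: its elements are the
   classes of Cauchy sequences modulo null sequences. *)
Record cstar := Cstar {
  cstar_class :> set (nat -> G -> R[i]);
  cstarP : exists2 u, cstar_cauchy u &
    cstar_class = [set w | cstar_cauchy w /\
                     cstar_norm (w k - u k) @[k --> \oo] --> (0 : R)] }.

(* pi extends to C*(G) by pi(a) v = lim pi(u_k) v for (u_k) in the class a. *)
Definition rep_kernel (H : hilbert R) (pi : urep [set: G] H) : set cstar :=
  [set a | forall u, cstar_class a u ->
             forall v, hcvg (fun k => integrated pi (u k) v) 0].

End GroupCstar.

Arguments cstar : clear implicits.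

(* Sets of (classes of) irreducible representations are Prop-valued functions:
   [set (irrep K)], hence also a topologicalType structure on [dual K], is a
   universe inconsistency because irrep quantifies over lmodType.  The topology
   of [dual] is therefore given by its open sets, the inverse images of the
   hull-kernel open sets under [pi] |-> ker pi. *)

Section Dual.
Variables (R : realType) (G : groupType).

Record irrep (K : set G) := Irrep {
  irrep_space : hilbert R;
  irrep_rep :> urep K irrep_space;
  irrep_irr : irreducible K irrep_rep }.

Record dual (K : set G) := Dual {
  dual_class : irrep K -> Prop;
  dualP : exists pi : irrep K,
    dual_class = fun pi' : irrep K => unitarily_equivalent pi pi' }.

Definition iclass (K : set G) (pi : irrep K) : dual K :=
  Dual (ex_intro _ pi (erefl (fun pi' : irrep K => unitarily_equivalent pi pi'))).

Definition primitive : set (set (cstar R G)) :=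
  [set P | exists pi : irrep [set: G], P = rep_kernel pi].

Definition jacobson_closed (Z : set (set (cstar R G))) : Prop :=
  Z `<=` primitive /\
  forall P, primitive P -> \bigcap_(Q in Z) Q `<=` P -> Z P.

Definition dual_kernel (x : dual [set: G]) : set (cstar R G) :=
  [set a | forall pi, dual_class x pi -> rep_kernel pi a].

Definition dual_open (U : dual [set: G] -> Prop) : Prop :=
  exists2 Z, jacobson_closed Z & forall x, U x <-> ~ Z (dual_kernel x).

Definition dual_cvg (p : nat -> dual [set: G]) (x : dual [set: G]) : Prop :=
  forall U, dual_open U -> U x -> \forall k \near \oo, U (p k).

End Dual.

Arguments irrep R {G} K.
Arguments dual R {G} K.

Record crystallographic (r : nat) (G : groupType) (N : set G)
    (D : finGroupType) (q : G -> D) : Prop := Crystallographic {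
  cryst_lattice : exists i : 'rV[int]_r -> G,
    [/\ injective i, forall a b, i (a + b) = (i a * i b)%g & range i = N];
  cryst_morph : forall x y, q (x * y)%g = (q x * q y)%g;
  cryst_surj : forall d, exists x, q x = d;
  cryst_ker : q @^-1` [set 1%g] = N;
  cryst_max : forall A : set G, subgroup A ->
    (forall x y, A x -> A y -> (x * y = y * x)%g) -> N `<=` A -> A = N }.

(* Only the values on N matter. *)
Record character (R : realType) (G : groupType) (N : set G) := Character {
  character_fun :> G -> R[i];
  character_norm : forall n, N n -> `|character_fun n| = 1;
  characterM : forall m n, N m -> N n ->
    character_fun (m * n)%g = character_fun m * character_fun n }.

Arguments character R {G} N.

Section Stabilizer.
Variables (R : realType) (G : groupType) (N : set G).

(* (g . chi)(n) = chi(g^-1 . n) = chi(g^-1 n g) *)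
Definition char_act (g : G) (chi : G -> R[i]) : G -> R[i] :=
  fun n => chi (g^-1 * n * g)%g.

Definition char_stab (chi : character R N) : set G :=
  [set g | forall n, N n -> char_act g chi n = chi n].

Variables (r : nat) (D : finGroupType) (q : G -> D).
Hypothesis hG : crystallographic r N q.

Lemma cryst_q1 : q 1%g = 1%g.
Proof.
by apply: (mulgI (q 1%g)); rewrite -(cryst_morph hG) !mulg1.
Qed.

Lemma cryst_qV x : q x^-1%g = (q x)^-1%g.
Proof.
by apply: (mulgI (q x)); rewrite -(cryst_morph hG) !mulgV cryst_q1.
Qed.

Lemma cryst_memN x : N x <-> q x = 1%g.
Proof. by rewrite -(cryst_ker hG). Qed.

Lemma cryst_normal g n : N n -> N (g^-1 * n * g)%g.
Proof.
move=> /cryst_memN qn; apply/cryst_memN.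
by rewrite !(cryst_morph hG) cryst_qV qn mulg1 mulVg.
Qed.

Lemma cryst_comm m n : N m -> N n -> (m * n = n * m)%g.
Proof.
have [i [_ iD <-]] := cryst_lattice hG.
by move=> [a _ <-] [b _ <-]; rewrite -!iD addrC.
Qed.

Lemma char_stab_subgroup chi : subgroup (char_stab chi).
Proof.
split=> [n _|x y xS yS n Nn]; first by rewrite /char_act invg1 mul1g mulg1.
have Nxn := cryst_normal x Nn.
have Nyn : N (y * (x^-1 * n * x) * y^-1)%g.
  by have := cryst_normal y^-1%g Nxn; rewrite invgK.
rewrite -(xS _ Nn) /char_act invMg invgK.
rewrite (_ : (_ * _ * _ * _)%g = (y * (x^-1 * n * x) * y^-1)%g); last first.
  by rewrite !mulgA.
by rewrite -(yS _ Nyn) /char_act !mulgA mulVg mul1g mulgKV.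
Qed.

Lemma char_stab_lattice chi : N `<=` char_stab chi.
Proof.
move=> g Ng n Nn; rewrite /char_act -mulgA (cryst_comm Nn Ng) mulgA.
by rewrite mulVg mul1g.
Qed.

Lemma char_stab_fin chi : finite_set (lcosets (char_stab chi)).
Proof.
have sS := char_stab_subgroup chi.
pose S := char_stab chi.
apply: (@sub_finite_set _ _
  ((fun d : D => lcoset S (xget 1%g [set x | q x = d])) @` [set: D])).
  move=> _ [x _ <-]; exists (q x) => //=.
  have : q (xget 1%g [set y | q y = q x]) = q x.
    by apply: (@xgetPex _ 1%g [set y | q y = q x]); exists x.
  move: (xget _ _) => y qy.
  have Sxy : S (x^-1 * y)%g.
    apply: char_stab_lattice; apply/cryst_memN.
    by rewrite (cryst_morph hG) cryst_qV qy mulVg.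
  apply/seteqP; split => z [k Sk <-].
    exists (x^-1 * y * k)%g; first exact: (subgroupM sS).
    by rewrite !mulgA mulgV mul1g.
  exists ((x^-1 * y)^-1 * k)%g; first 
    by apply: (subgroupM sS) => //; exact: (subgroupV sS).
  by rewrite invMg invgK !mulgA mulgV mul1g.
by apply: finite_image; exact: finite_finset.
Qed.

Definition stabilizer (chi : character R N) : fisubgroup G :=
  FiSubgroup (char_stab_subgroup chi) (char_stab_fin chi).

End Stabilizer.

(* The classes of irreducible representations of K restricting on N to a
   finite multiple of chi. *)
Definition dual_over (R : realType) (G : groupType) (N : set G)
    (chi : character R N) (K : set G) (x : dual R K) : Prop :=
  exists2 pi, dual_class x pi & exists m : nat,
    [/\ (0 < m)%N, has_dim (irrep_space pi) m
      & forall n v, N n -> pi n v = chi n *: v].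

Section Generic.
Variables (R : realType) (G : groupType) (N : set G).
Variables (D : finGroupType) (q : G -> D) (gam : D -> G).

Definition nu (h k : D) : G := ((gam (h * k))^-1 * (gam h * gam k))%g.

Definition omega (chi : character R N) (h k : D) : R[i] :=
  Num.conj (chi (nu h k)).

Definition char_star (chi : character R N) (x : G) : R[i] :=
  chi ((gam (q x))^-1 * x)%g.

Definition coboundary (lam : D -> R[i]) (x y : D) : R[i] :=
  lam (x * y)%g * (lam x * lam y)^-1.

Definition projective_rep (Q : set D) (om : D -> D -> R[i]) (H : hilbert R)
    (P : D -> H -> H) : Prop :=
  (forall x, Q x -> unitary_op (P x)) /\
  forall x y v, Q x -> Q y -> P (x * y)%g v = om x y *: P x (P y v).

Record generic_data (chi : nat -> character R N) (chil : character R N)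
    (Gs : set G) (n : nat) (H : hilbert R)
    (sigma : nat -> urep Gs H) (sigmal : urep Gs H)
    (lam : nat -> D -> R[i]) (laml : D -> R[i]) (Phi : D -> H -> H) : Prop :=
  GenericData {
  (* R[i] carries its topology through the alias R[i]^o. *)
  gen_cvg : forall m, N m ->
    chi k m @[k --> \oo] --> (chil m : R[i]^o);
  gen_stab : forall k, char_stab (chi k) = Gs;
  gen_dim : has_dim H n;
  gen_lam_norm : forall k d, (q @` Gs) d -> `|lam k d| = 1;
  gen_lam1 : forall k, lam k 1%g = 1;
  gen_lam0 : forall d, (q @` Gs) d -> lam 0%N d = 1;
  gen_omega : forall k x y, (q @` Gs) x -> (q @` Gs) y ->
    omega (chi k) x y = omega (chi 0%N) x y * coboundary (lam k) x y;
  gen_lam_cvg : forall d, (q @` Gs) d ->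
    lam k d @[k --> \oo] --> (laml d : R[i]^o);
  gen_Phi : projective_rep (q @` Gs) (omega (chi 0%N)) Phi;
  gen_Phi_irr : irreducible (q @` Gs) Phi;
  gen_sigma : forall k x v, Gs x ->
    sigma k x v = (char_star (chi k) x * lam k (q x)) *: Phi (q x) v;
  gen_sigmal : forall x v, Gs x ->
    sigmal x v = (char_star chil x * laml (q x)) *: Phi (q x) v }.

Definition generic_sequence (chi : nat -> character R N)
    (chil : character R N) (Gs : set G) (n : nat) (H : hilbert R)
    (sigma : nat -> urep Gs H) (sigmal : urep Gs H) : Prop :=
  exists (lam : nat -> D -> R[i]) (laml : D -> R[i]) (Phi : D -> H -> H),
    generic_data chi chil n sigma sigmal lam laml Phi.

End Generic.

(* Main.v *)
Require Import Defs.
From HB Require Import structures.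
From mathcomp Require Import all_boot all_order all_algebra all_fingroup.
From mathcomp Require Import sesquilinear complex finmap.
From mathcomp Require Import all_classical all_reals.
From mathcomp Require Import topology normedtype sequences.
From mathcomp Require Import ring lra.

(* Restricted to N, ind sigma_k is diagonal with weights in the G-orbit of
   chi_k, and functions in the induced space can be truncated to single cosets
   by polynomials in N; this gives Mackey's irreducibility criterion, and
   conversely an irreducible representation of G with a chi-eigenvector is
   finite-dimensional and induced from its chi-eigenspace.

   Existence of limits: sigma_k -> sigma pointwise, so an element of C*(G)
   killed by infinitely many ind sigma_k is killed by ind sigma, hence by the
   irreducible subrepresentations of ind sigma, and one of these contains a
   chi-eigenvector.

   Every limit pi is of this form: for a family (n_d) in N indexed by D, the
   product of the n_d - (d.chi)(n_d) has norm tending to 0 in ind sigma_k.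
   Applying the function t |-> t + |t| to a^* a - eps, where a is this product,
   gives an element of C*(G) that ind sigma_k kills for large k; so pi kills it,
   and letting eps tend to 0 the product vanishes in pi.  As this holds for
   all families, pi has an N-eigenvector with character in the orbit of chi. *)

Set Implicit Arguments.
Unset Strict Implicit.
Unset Printing Implicit Defensive.

Import Order.TTheory GRing.Theory Num.Theory numFieldNormedType.Exports.
Import Normc.
Local Open Scope classical_set_scope.
Local Open Scope ring_scope.

(** * Hilbert spaces *)

(** The topology of the dual only ever yields inclusions of kernels, so for the second claim the
    smallness of a product a in ind sigma_k has to become exact vanishing of one element of C*(G).
    The thresholds serve this: with T = (a^* a - eps) / 2, a norm at most c with c^2 <= eps / 2 puts
    T below -eps / 4, hence T + |T| = 0, whereas T + |T| = 0 in pi says T <= 0, that is |a v|^2 <=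
    eps |v|^2. As elements of C*(G) are given by Cauchy sequences in C[G], |T| is approximated by
    polynomials in T, at a rate uniform over all representations. The limit pi is not known in
    advance to have any N-eigenvector, so one is extracted algebraically from the vanishing of
    products. One factor for each class in D suffices since N is abelian: conjugation on N factors
    through D. In the first claim ind sigma is in general reducible, as G_* can be smaller than
    G_chi. Moreover the spaces of ind sigma_k vary with k, because equivariance involves sigma_k, so
    vectors have to be carried from one space to another. *)

Section HilbertTheory.
Variables (R : realType) (H : hilbert R).
Implicit Types (u v w : H) (a b : R[i]).
Local Notation "<< u , v >>" := (hdot H u v) (at level 0).

Lemma normCE a : `|a| = (normc a)%:C%C.
Proof. by case: a. Qed.

Lemma normc_ge0 a : 0 <= normc a.
Proof. by rewrite -ler0c -normCE. Qed.

Lemma normc_real (x : R) : normc x%:C%C = `|x|.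
Proof. by rewrite /= expr0n addr0 sqrtr_sqr. Qed.

Lemma hdotC u v : <<v, u>> = Num.conj <<u, v>>.
Proof. by rewrite [LHS](@hermitian_subproof _ _ _ _ (hdot H)) expr0 mul1r. Qed.

Lemma hdot_sqr v : <<v, v>> = (hnorm v ^+ 2)%:C%C.
Proof.
rewrite /hnorm dnorm_sqr.
have : 0 <= <<v, v>> by exact: sesquilinear.dnorm_ge0.
by case: <<v, v>> => x y; rewrite lecE /= => /andP[/eqP -> _].
Qed.

Lemma hnorm_ge0 v : 0 <= hnorm v. Proof. exact: Defs.dnorm_ge0. Qed.

Lemma hnorm0 : hnorm (0 : H) = 0.
Proof. by rewrite /hnorm /dnorm linear0l sqrtr0. Qed.

Lemma hnorm_eq0 v : hnorm v = 0 -> v = 0. Proof. exact: Defs.dnorm_eq0. Qed.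

Lemma hdot_eq0 v : <<v, v>> = 0 -> v = 0.
Proof.
rewrite hdot_sqr => -[] /eqP; rewrite sqrf_eq0 => /eqP; exact: hnorm_eq0.
Qed.

Lemma hdotDl u v w : <<u + v, w>> = <<u, w>> + <<v, w>>.
Proof. exact: linearDl. Qed.

Lemma hdotDr u v w : <<u, v + w>> = <<u, v>> + <<u, w>>.
Proof. exact: linearDr. Qed.

Lemma hdotBl u v w : <<u - v, w>> = <<u, w>> - <<v, w>>.
Proof. exact: linearBl. Qed.

Lemma hdotBr u v w : <<u, v - w>> = <<u, v>> - <<u, w>>.
Proof. exact: linearBr. Qed.

Lemma hdotZl a u v : <<a *: u, v>> = a * <<u, v>>.
Proof. exact: linearZl_LR. Qed.

Lemma hdotZr a u v : <<u, a *: v>> = Num.conj a * <<u, v>>.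
Proof. exact: (linearZr_LR (hdot H)). Qed.

Lemma hdot0l v : <<0, v>> = 0. Proof. exact: linear0l. Qed.
Lemma hdot0r v : <<v, 0>> = 0. Proof. exact: linear0r. Qed.

Lemma hdot_suml I (r : seq I) (F : I -> H) v :
  << \sum_(i <- r) F i, v>> = \sum_(i <- r) <<F i, v>>.
Proof. exact: linear_sumlz. Qed.

Lemma hdot_sumr I (r : seq I) (F : I -> H) v :
  <<v, \sum_(i <- r) F i>> = \sum_(i <- r) <<v, F i>>.
Proof. exact: linear_sumr. Qed.

Lemma hnormZ a v : hnorm (a *: v) = normc a * hnorm v.
Proof.
apply/eqP; rewrite -(@eqrXn2 _ 2)// ?mulr_ge0 ?normc_ge0 ?hnorm_ge0//.
rewrite -(inj_eq (@complexI R)) -hdot_sqr hdotZl hdotZr hdot_sqr mulrA -normCK.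
by rewrite normCE -rmorphXn -rmorphM -exprMn.
Qed.

Lemma hnormN v : hnorm (- v) = hnorm v.
Proof. by rewrite -scaleN1r hnormZ normcN normc1 mul1r. Qed.

Lemma hnormBC u v : hnorm (u - v) = hnorm (v - u).
Proof. by rewrite -hnormN opprB. Qed.

(** Cauchy-Schwarz, read off from the squared norm of [w], the component of [u] orthogonal to [v]
    multiplied by |v|^2 to avoid a division. *)
Lemma hdot_le u v : normc <<u, v>> <= hnorm u * hnorm v.
Proof.
have [->|v0] := eqVneq v 0; first by rewrite hdot0r hnorm0 mulr0 normc0.
have vgt0 : 0 < hnorm v.
  by rewrite lt_def hnorm_ge0 andbT; apply: contraNneq v0 => /hnorm_eq0 ->.
pose c := <<u, v>>; pose w := (hnorm v ^+ 2)%:C%C *: u - c *: v.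
have realC (x : R) : Num.conj x%:C%C = x%:C%C.
  by rewrite -[LHS]/(conjc _) conjc_real.
have ww : <<w, w>> =
    ((hnorm v ^+ 2) * ((hnorm u * hnorm v) ^+ 2 - normc c ^+ 2))%:C%C.
  rewrite /w hdotBl !hdotBr !hdotZl !hdotZr !hdot_sqr -/c (hdotC u v) -/c realC.
  have cc : c * Num.conj c = (normc c ^+ 2)%:C%C.
    by rewrite -normCK normCE -rmorphXn.
  rewrite !rmorphM rmorphB /= -cc !rmorphXn/= rmorphM/=; ring.
rewrite -(@ler_pXn2r _ 2) ?nnegrE ?normc_ge0 ?mulr_ge0 ?hnorm_ge0//.
have := sqr_ge0 (hnorm w).
have -> : hnorm w ^+ 2 =
  (hnorm v ^+ 2) * ((hnorm u * hnorm v) ^+ 2 - normc c ^+ 2).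
  by apply: (@complexI R); rewrite -hdot_sqr ww.
by rewrite pmulr_rge0 ?exprn_gt0// subr_ge0.
Qed.

Lemma Re_le_normc a : complex.Re a <= normc a.
Proof.
case: a => x y /=; apply: le_trans (ler_norm _) _.
by rewrite -sqrtr_sqr ler_sqrt ?lerDl ?addr_ge0 ?sqr_ge0.
Qed.

Lemma hnormD u v : hnorm (u + v) <= hnorm u + hnorm v.
Proof.
rewrite -(@ler_pXn2r _ 2)// ?nnegrE ?addr_ge0 ?hnorm_ge0//.
have -> : hnorm (u + v) ^+ 2 =
    hnorm u ^+ 2 + hnorm v ^+ 2 + 2 * complex.Re <<u, v>>.
  apply: (@complexI R); rewrite -hdot_sqr hdotDl !hdotDr !hdot_sqr (hdotC u v).
  have -> : <<u, v>> = (complex.Re <<u, v>> +i* complex.Im <<u, v>>)%C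
    by case: <<u, v>>.
  by apply/eqP; rewrite eq_complex /=; apply/andP; split; apply/eqP; ring.
have := le_trans (Re_le_normc _) (hdot_le u v); lra.
Qed.

Lemma hnormB u v : hnorm (u - v) <= hnorm u + hnorm v.
Proof. by rewrite -(hnormN v); exact: hnormD. Qed.

Lemma hnorm_sub_le u v : hnorm u <= hnorm v + hnorm (u - v).
Proof. by rewrite -[X in hnorm X <= _](subrKC v); exact: hnormD. Qed.

Lemma hnorm_sum I (r : seq I) (F : I -> H) :
  hnorm (\sum_(i <- r) F i) <= \sum_(i <- r) hnorm (F i).
Proof.
elim: r => [|i r IHr]; first by rewrite !big_nil hnorm0.
by rewrite !big_cons; apply: le_trans (hnormD _ _) _; rewrite lerD2l.
Qed.

Lemma hcvgP (u : nat -> H) l : hcvg u l <->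
  forall e : R, 0 < e -> \forall k \near \oo, hnorm (u k - l) < e.
Proof.
split=> [/cvgrPdist_lt ul e /ul|ul].
  apply: filterS => k; rewrite sub0r normrN ger0_norm//; exact: hnorm_ge0.
apply/cvgrPdist_lt => e /ul; apply: filterS => k.
by rewrite sub0r normrN ger0_norm//; exact: hnorm_ge0.
Qed.

End HilbertTheory.

(** * Orthonormal families and finite-dimensional subspaces *)

Section FiniteSpans.
Variables (R : realType) (H : hilbert R).
Implicit Types (u v w : H) (W V : set H) (f : nat -> H).
Local Notation "<< u , v >>" := (hdot H u v) (at level 0).

Definition lin_subspace W : Prop :=
  W 0 /\ forall (a : R[i]) u v, W u -> W v -> W (a *: u + v).

Lemma closed_lin_subspace W : closed_subspace W -> lin_subspace W.
Proof. by case. Qed.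

Lemma lin_subspaceZ W a v : lin_subspace W -> W v -> W (a *: v).
Proof. by case=> W0 WD Wv; rewrite -[_ *: _]addr0; exact: WD. Qed.

Lemma lin_subspaceD W u v : lin_subspace W -> W u -> W v -> W (u + v).
Proof. by case=> W0 WD Wu Wv; rewrite -[u]scale1r; exact: WD. Qed.

Lemma lin_subspaceB W u v : lin_subspace W -> W u -> W v -> W (u - v).
Proof.
by move=> sW Wu Wv; apply: lin_subspaceD => //; rewrite -scaleN1r;
  exact: lin_subspaceZ.
Qed.

Lemma lin_subspace_sum W (I : Type) (r : seq I) (P : pred I) (F : I -> H) :
  lin_subspace W -> (forall i, P i -> W (F i)) -> W (\sum_(i <- r | P i) F i).
Proof.
move=> sW WF; elim/big_ind: _ => //; first by case: sW.
by move=> u v; exact: lin_subspaceD.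
Qed.

Definition lspan (I : finType) (e : I -> H) : set H :=
  [set \sum_i c i *: e i | c in [set: I -> R[i]]].

Lemma lspan_lin (I : finType) (e : I -> H) : lin_subspace (lspan e).
Proof.
split=> [|a _ _ [b _ <-] [c _ <-]].
  by exists (fun=> 0) => //; rewrite big1// => i _; rewrite scale0r.
exists (fun i => a * b i + c i) => //; rewrite scaler_sumr -big_split/=.
by apply: eq_bigr => i _; rewrite scalerDl scalerA.
Qed.

Lemma lspan_gen (I : finType) (e : I -> H) i : lspan e (e i).
Proof.
exists (fun j => (j == i)%:R) => //;
  rewrite (bigD1 i)//= eqxx scale1r big1 ?addr0//.
by move=> j /negbTE ->; rewrite scale0r.
Qed.

Lemma lspan_sub (I : finType) (e : I -> H) W :
  lin_subspace W -> (forall i, W (e i)) -> lspan e `<=` W.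
Proof.
by move=> sW We _ [c _ <-]; apply: lin_subspace_sum => // i _;
  exact: lin_subspaceZ.
Qed.

(** The family is a total function on [nat] of which only the first [m] values count, so that
    extending or truncating it does not change its type. *)
Definition orthofam W m f : Prop :=
  (forall i, (i < m)%N -> W (f i)) /\
  forall i j, (i < m)%N -> (j < m)%N -> <<f i, f j>> = (i == j)%:R.

Lemma orthofam_dot W m f (c : nat -> R[i]) j : orthofam W m f -> (j < m)%N ->
  << \sum_(i < m) c i *: f i, f j>> = c j.
Proof.
move=> [_ fo] jm; rewrite hdot_suml (bigD1 (Ordinal jm))//=.
rewrite hdotZl fo// eqxx mulr1.
rewrite big1 ?addr0// => i ij; rewrite hdotZl fo// [_ == _](negbTE _) ?mulr0//.

Qed.

(** With more than |I| vectors the coefficient matrix has a nonzero row in its left kernel, that is,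
    a linear relation among the [f i]; pairing it with [f j] makes every coefficient vanish. *)
Lemma orthofam_bound (I : finType) (e : I -> H) m f :
  orthofam (lspan e) m f -> (m <= #|I|)%N.
Proof.
move=> [fe fo].
have /choice[c ce] (i : 'I_m) : exists c : I -> R[i], \sum_j c j *: e j = f i.
  by have [c _ <-] := fe _ (ltn_ord i); exists c.
pose C : 'M[R[i]]_(m, #|I|) := \matrix_(i, j) c i (enum_val j).
rewrite leqNgt; apply/negP => Im.
have : kermx C != 0.
  rewrite kermx_eq0 /row_free; apply/eqP => rC.
  by have := rank_leq_col C; rewrite rC leqNgt Im.
case/rowV0Pn => u /sub_kermxP uC; apply/negP; rewrite negbK;
  apply/eqP/rowP => j.
pose u' i : R[i] := if insub i is Some k then u 0 k else 0.
have u'E (k : 'I_m) : u' k = u 0 k by rewrite /u' valK.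
rewrite mxE -u'E -(orthofam_dot u' (conj fe fo) (ltn_ord j)).
rewrite (_ : \sum_(i < m) _ = 0) ?hdot0l//.
under eq_bigr do rewrite u'E -ce scaler_sumr.
rewrite exchange_big/= big1// => k _.
under eq_bigr do rewrite scalerA.
rewrite -scaler_suml (_ : \sum_(i < m) _ = 0) ?scale0r//.
move/rowP/(_ (enum_rank k)): uC; rewrite !mxE => uC; rewrite -[RHS]uC.
by apply: eq_bigr => i _; rewrite mxE enum_rankK.
Qed.

(** One Gram-Schmidt step: the remainder of [w], normalised, goes into position [m]. *)
Lemma orthofam_extend W m f w : lin_subspace W -> orthofam W m f -> W w ->
  w != \sum_(i < m) <<w, f i>> *: f i -> exists g, orthofam W m.+1 g.
Proof.
move=> sW fo Ww; rewrite -subr_eq0; set p := w - _ => p0.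
have [fW fo'] := fo.
have Wp : W p.
  apply: lin_subspaceB => //; apply: lin_subspace_sum => // i _.
  by apply: lin_subspaceZ => //; exact: fW.
have pf j : (j < m)%N -> <<p, f j>> = 0.
  by move=> jm; rewrite hdotBl (orthofam_dot (fun i => <<w, f i>>) fo jm) subrr.
have pn : hnorm p != 0 by apply: contraNneq p0 => /hnorm_eq0 ->.
pose x := ((hnorm p)^-1)%:C%C *: p.
have fx i : (i < m)%N -> <<x, f i>> = 0 by move=> im; rewrite hdotZl pf// mulr0.
have xx : <<x, x>> = 1.
  rewrite hdot_sqr hnormZ normc_real ger0_norm ?invr_ge0 ?hnorm_ge0// mulVf//.
  by rewrite expr1n.
have W_x : W x by exact: lin_subspaceZ.
exists (fun i => if (i < m)%N then f i else x); split=> [i _|i j].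
  by case: ifP => // /fW.
rewrite !ltnS => im jm.
case: ltnP => im'; case: ltnP => jm'.
- exact: fo'.
- by rewrite hdotC fx// rmorph0 ltn_eqF// (leq_trans im').
- by rewrite fx// gtn_eqF// (leq_trans jm').
- by rewrite xx (_ : i == j)// eqn_leq (leq_trans im jm') (leq_trans jm im').
Qed.

Lemma orthofam_basis W (M : nat) : lin_subspace W ->
  (forall m f, orthofam W m f -> (m <= M)%N) ->
  exists m f, orthofam W m f /\ forall w, W w ->
    w = \sum_(i < m) <<w, f i>> *: f i.
Proof.
move=> sW WM.
have W0 : exists m, `[< exists f, orthofam W m f >].
  by exists 0%N; apply/asboolP; exists (fun=> 0).
have WM' m : `[< exists f, orthofam W m f >] -> (m <= M)%N
  by move=> /asboolP[f /WM].
case: (ex_maxnP W0 WM') => m /asboolP[f fo] mmax; exists m, f; split=> // w Ww.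
apply: contrapT => /eqP /(orthofam_extend sW fo Ww)[g go].
by have /mmax : `[< exists f, orthofam W m.+1 f >];
  [apply/asboolP; exists g|rewrite ltnn].
Qed.

Lemma orthofamS W V m f : W `<=` V -> orthofam W m f -> orthofam V m f.
Proof. by move=> WV [fW fo]; split=> // i /fW /WV. Qed.

Lemma orthofam_leq W m k f : (k <= m)%N -> orthofam W m f -> orthofam W k f.
Proof.
move=> km [fW fo]; split=> [i ik|i j ik jk]; first by apply: fW;
  exact: leq_trans km.
by apply: fo; exact: leq_trans km.
Qed.

(* Dimension is measured by the length of orthonormal families: a member whose
   orthonormal families have the least maximal length is minimal. *)
Lemma lspan_minimal (I : finType) (e : I -> H) (F : set (set H)) :
  F !=set0 -> (forall W, F W -> lin_subspace W /\ W `<=` lspan e) ->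
  exists2 W, F W & forall V, F V -> V `<=` W -> V = W.
Proof.
move=> [W0 FW0] FP.
pose P p := `[< exists2 W, F W & forall m f, orthofam W m f -> (m <= p)%N >].
have exP : exists p, P p.
  exists #|I|; apply/asboolP; exists W0 => // m f /(orthofamS (FP _ FW0).2).
  exact: orthofam_bound.
case: (ex_minnP exP) => p /asboolP[W FW Wp] pmin; exists W => // V FV VW.
apply/seteqP; split=> // w Ww.
have [f fo] : exists f, orthofam V p f.
  case: p => [|p] in Wp pmin *; first by exists (fun=> 0).
  apply: contrapT => nV; have /pmin : P p; last by rewrite ltnn.
  apply/asboolP; exists V => // m f fo; rewrite leqNgt; apply/negP => pm.
  by apply: nV; exists f; exact: orthofam_leq fo.
have sV := (FP _ FV).1.
have -> : w = \sum_(i < p) <<w, f i>> *: f i.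
  apply: contrapT => /eqP.
  move=> /(orthofam_extend (FP _ FW).1 (orthofamS VW fo) Ww)[g /Wp].
  by rewrite ltnn.
by apply: lin_subspace_sum => // i _; apply: lin_subspaceZ => //; exact: fo.1.
Qed.

(** The projection [P] is bounded and fixes each [u k], so l - P l = (l - u k) - P (l - u k) is
    arbitrarily small. *)
Lemma orthofam_closed W m f : lin_subspace W -> orthofam W m f ->
  (forall w, W w -> w = \sum_(i < m) <<w, f i>> *: f i) -> closed_subspace W.
Proof.
move=> sW fo fW; split; [exact: sW.1|exact: sW.2|move=> u l Wu ul].
pose P v := \sum_(i < m) <<v, f i>> *: f i.
have PW v : W (P v).
  by apply: lin_subspace_sum => // i _; apply: lin_subspaceZ => //; exact: fo.1.
have PB v w : P (v - w) = P v - P w.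
  by rewrite /P -sumrB; apply: eq_bigr => i _; rewrite hdotBl scalerBl.
have P_le v : hnorm (P v) <= (\sum_(i < m) hnorm (f i) ^+ 2) * hnorm v.
  apply: le_trans (hnorm_sum _ _) _; rewrite mulr_suml; apply: ler_sum => i _.
  rewrite hnormZ expr2 -mulrA mulrC; apply: ler_wpM2l; first exact: hnorm_ge0.
  by rewrite mulrC hdot_le.
pose C := 1 + \sum_(i < m) hnorm (f i) ^+ 2.
have C0 : 0 < C by rewrite ltr_wpDr// sumr_ge0// => i _; exact: sqr_ge0.
suff -> : l = P l by exact: PW.
apply/eqP; rewrite -subr_eq0; apply/eqP/hnorm_eq0/eqP;
  rewrite eq_le hnorm_ge0 andbT.
apply/ler_addgt0Pl => e e0; rewrite addr0.
move/hcvgP : ul => /(_ (e / C)); rewrite divr_gt0// =>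
  /(_ isT)[k _ /(_ _ (leqnn k))/= ulk].
have -> : l - P l = (l - u k) - P (l - u k)
  by rewrite PB (_ : P (u k) = u k) ?opprB ?addrA ?subrK// /P -fW.
apply: le_trans (hnormB _ _) _.
move: ulk; rewrite hnormBC ltr_pdivlMr// => /ltW; apply: le_trans.
by rewrite mulrC /C mulrDl mul1r lerD2l; exact: P_le.
Qed.

Lemma lspan_basis (I : finType) (e : I -> H) :
  exists m f, orthofam (lspan e) m f /\
    forall w, lspan e w -> w = \sum_(i < m) <<w, f i>> *: f i.
Proof.
by apply: orthofam_basis (@orthofam_bound I e); exact: lspan_lin.
Qed.

Lemma lspan_closed (I : finType) (e : I -> H) : closed_subspace (lspan e).
Proof.
have [m [f [fo fW]]] := lspan_basis e.
exact: orthofam_closed (lspan_lin e) fo fW.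
Qed.

Lemma lspan_has_dim (I : finType) (e : I -> H) : lspan e = setT ->
  exists m, has_dim H m.
Proof.
move=> eT; have [m [f [fo fW]]] := lspan_basis e.
exists m, (fun i : 'I_m => f i), (fun v => \row_i <<v, f i>>) => [c|v].
  apply/rowP => i; rewrite mxE.
  pose c' k : R[i] := if insub k is Some k then c 0 k else 0.
  transitivity (c' i); last by rewrite /c' valK.
  rewrite -(orthofam_dot c' fo (ltn_ord i)).
  by congr (hdot H _ _); apply: eq_bigr => j _; rewrite /c' valK.
rewrite [RHS]fW ?eT//; apply: eq_bigr => i _; by rewrite mxE.
Qed.

End FiniteSpans.

(** * Representations and subrepresentations *)

Section RepTheory.
Variables (R : realType) (G : groupType) (K : set G) (H : hilbert R).
Variable pi : urep K H.
Hypothesis sK : subgroup K.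

Lemma urepD x u v : K x -> pi x (u + v) = pi x u + pi x v.
Proof. by move=> Kx; have := urep_linear pi Kx 1 u v; rewrite !scale1r. Qed.

Lemma urepZ x a v : K x -> pi x (a *: v) = a *: pi x v.
Proof.
by move=> Kx; have := urep_linear pi Kx a v 0; rewrite !addr0 urep0// addr0.
Qed.

Lemma urep_sum x I (r : seq I) (P : pred I) (F : I -> H) : K x ->
  pi x (\sum_(i <- r | P i) F i) = \sum_(i <- r | P i) pi x (F i).
Proof.
move=> Kx; elim/big_ind2: _ => //; first by rewrite urep0.
by move=> _ u _ v <- <-; rewrite urepD.
Qed.

(** Follows from multiplicativity: [pi 1] is isometric and idempotent, so |pi 1 v - v| = |pi 1 (pi 1
    v - v)| = 0. *)
Lemma urep1 v : pi 1%g v = v.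
Proof.
have K1 := sK.1; apply/eqP; rewrite -subr_eq0; apply/eqP/hnorm_eq0.
by rewrite -(urep_norm pi _ K1) urepB// -urepM// mulg1 subrr hnorm0.
Qed.

Lemma urepVK x v : K x -> pi x (pi x^-1%g v) = v.
Proof.
by move=> Kx; rewrite -urepM ?mulgV ?urep1//; exact: subgroupV.
Qed.

Lemma urep_dotV x u v : K x -> hdot H (pi x u) v = hdot H u (pi x^-1%g v).
Proof. by move=> Kx; rewrite -[in LHS](urepVK v Kx) urep_dot. Qed.

End RepTheory.

Lemma subgroupT (G : groupType) : subgroup [set: G].
Proof. by []. Qed.

(** * Closed subspaces as Hilbert spaces, and subrepresentations *)

Section Subspace.
Variables (R : realType) (H : hilbert R) (W : set H).
Hypothesis Wc : closed_subspace W.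

(** The proof of closedness is an argument so that the submodule structure attached to the predicate
    can be inferred from it. *)
Definition subspace_pred of closed_subspace W : pred H := fun v => `[< W v >].
Local Notation P := (subspace_pred Wc).

Lemma subspace_submod : subsemimod_closed P.
Proof.
have sW := closed_lin_subspace Wc; split; [split|].
- by apply/asboolP; exact: sW.1.
- by move=> u v /asboolP Wu /asboolP Wv; apply/asboolP; exact: lin_subspaceD.
- by move=> a u /asboolP Wu; apply/asboolP; exact: lin_subspaceZ.
Qed.

HB.instance Definition _ :=
  GRing.isSubmodClosed.Build R[i] H P subspace_submod.

Record subspace := Subspace {
  subspace_val :> H;
  subspaceP : subspace_val \in P }.

HB.instance Definition _ := [isSub for subspace_val].
HB.instance Definition _ := [Choice of subspace by <:].
HB.instance Definition _ := [SubChoice_isSubLmodule of subspace by <:].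

Definition subspace_dot (u v : subspace) : R[i] := hdot H u v.

Lemma subspace_dotl_zmod v : zmod_morphism (subspace_dot^~ v).
Proof. by move=> u u'; exact: hdotBl. Qed.

Lemma subspace_dotr_zmod u : zmod_morphism (subspace_dot u).
Proof. by move=> v v'; exact: hdotBr. Qed.

Lemma subspace_dotl_scal v : scalable_for *%R (subspace_dot^~ v).
Proof. by move=> a u; exact: hdotZl. Qed.

Lemma subspace_dotr_scal u :
  scalable_for (Num.conj \; *%R) (subspace_dot u).
Proof. by move=> a v; exact: hdotZr. Qed.

HB.instance Definition _ := isBilinear.Build R[i] subspace subspace R[i]
  *%R (Num.conj \; *%R) subspace_dot
  subspace_dotl_zmod subspace_dotr_zmod subspace_dotl_scal subspace_dotr_scal.

Lemma subspace_dot_herm u v :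
  subspace_dot u v = (-1) ^+ false * Num.conj (subspace_dot v u).
Proof. by rewrite expr0 mul1r; exact: hdotC. Qed.

HB.instance Definition _ := isHermitianSesquilinear.Build R[i] subspace
  false Num.conj subspace_dot subspace_dot_herm.

Lemma subspace_dot_gt0 v : v != 0 -> 0 < subspace_dot v v.
Proof.
by move=> v0; rewrite /subspace_dot sesquilinear.dnorm_gt0.
Qed.

HB.instance Definition _ := isDotProduct.Build R[i] subspace subspace_dot
  subspace_dot_gt0.

Lemma subspace_complete (u : nat -> subspace) :
  dcauchy subspace_dot u -> exists l, dcvg subspace_dot u l.
Proof.
move=> uC.
have [|l ul] := @hilbert_complete _ H (fun k => u k : H); first exact: uC.
have Pl : l \in P.
  apply/asboolP; case: Wc => _ _ /(_ (fun k => u k)); apply=> // k.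
  by have /asboolP := subspaceP (u k).
by exists (Subspace Pl).
Qed.

Definition subspace_hilbert : hilbert R := Hilbert subspace_complete.

Lemma subspace_in (v : subspace) : W v.
Proof. by have /asboolP := subspaceP v. Qed.

Lemma subspace_memP v : W v -> v \in P.
Proof. by move=> Wv; apply/asboolP. Qed.

Lemma subspace_closed (V : set subspace_hilbert) :
  closed_subspace V -> closed_subspace [set val v | v in V].
Proof.
move=> [V0 VD Vl]; split.
- by exists 0.
- by move=> a _ _ [u Vu <-] [v Vv <-]; exists (a *: u + v) => //; exact: VD.
- move=> u l uV ul.
  have /choice[u' u'P] k : exists v, V v /\ val v = u k.
    by have [v ? ?] := uV k; exists v.
  have Wl : W l.
    case: Wc => _ _; apply; last exact: ul.
    by move=> k; have [_ <-] := u'P k; exact: subspace_in.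
  exists (Subspace (subspace_memP Wl)) => //.
  apply: (Vl u') => [k|]; first by have [] := u'P k.
  move: ul; rewrite (_ : u = fun k => val (u' k))//.
  by apply/funext => k; have [_ <-] := u'P k.
Qed.

Section Subrep.
Variables (G : groupType) (L K : set G) (pi : urep L H).
Hypotheses (sK : subgroup K) (KL : K `<=` L).
Hypothesis WK : forall x v, K x -> W v -> W (pi x v).
Hypothesis sL : subgroup L.

(** The default value 0 of [insubd] is reached only for [x] outside [K], where the values of a
    representation do not count. *)
Definition subrep_fun (x : G) (v : subspace_hilbert) : subspace_hilbert :=
  insubd (0 : subspace) (pi x (val v)).

Lemma val_subrep x v : K x -> val (subrep_fun x v) = pi x (val v).
Proof.
move=> Kx; rewrite val_insubd.
by rewrite (subspace_memP (WK Kx (subspace_in v))).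
Qed.

Lemma subrep_unitary x : K x -> unitary_op (subrep_fun x).
Proof.
move=> Kx; split=> [a u v|u v|w].
- by apply: val_inj; rewrite !linearP/= !val_subrep// !linearP/= urep_linear//;
  exact: KL.
- by rewrite -[LHS]/(hdot H (val _) (val _)) !val_subrep// urep_dot//;
  exact: KL.
- exists (subrep_fun x^-1%g w); apply: val_inj.
  by rewrite !val_subrep ?urepVK//; [exact: KL|exact: subgroupV].
Qed.

Lemma subrepM x y v : K x -> K y ->
  subrep_fun (x * y)%g v = subrep_fun x (subrep_fun y v).
Proof.
move=> Kx Ky; apply: val_inj.
by rewrite !val_subrep ?urepM//; [exact: KL|exact: KL|exact: subgroupM].
Qed.

Definition subrep : urep K subspace_hilbert := Urep subrep_unitary subrepM.

End Subrep.

End Subspace.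

Section Equivalence.
Variables (R : realType).

Lemma unitary_op0 (H1 H2 : hilbert R) (T : H1 -> H2) : unitary_op T -> T 0 = 0.
Proof.
case=> T1 _ _; have := T1 (-1) 0 0.
by rewrite !scaleN1r oppr0 addr0 addNr.
Qed.

Lemma unitary_opZ (H1 H2 : hilbert R) (T : H1 -> H2) a v :
  unitary_op T -> T (a *: v) = a *: T v.
Proof.
move=> uT; have [T1 _ _] := uT.
by have := T1 a v 0; rewrite !addr0 (unitary_op0 uT) addr0.
Qed.

Lemma unitary_opD (H1 H2 : hilbert R) (T : H1 -> H2) u v :
  unitary_op T -> T (u + v) = T u + T v.
Proof. by case=> T1 _ _; have := T1 1 u v; rewrite !scale1r. Qed.

Lemma unitary_opN (H1 H2 : hilbert R) (T : H1 -> H2) v :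
  unitary_op T -> T (- v) = - T v.
Proof. by move=> uT; rewrite -scaleN1r unitary_opZ// scaleN1r. Qed.

Lemma unitary_op_norm (H1 H2 : hilbert R) (T : H1 -> H2) v :
  unitary_op T -> hnorm (T v) = hnorm v.
Proof. by case=> _ T2 _; rewrite /hnorm /dnorm T2. Qed.

Lemma unitary_op_inj (H1 H2 : hilbert R) (T : H1 -> H2) :
  unitary_op T -> injective T.
Proof.
move=> uT u v uv; apply/eqP; rewrite -subr_eq0; apply/eqP/hnorm_eq0.
by rewrite -(unitary_op_norm _ uT) unitary_opD// unitary_opN// uv subrr hnorm0.
Qed.

Lemma unitary_op_inv (H1 H2 : hilbert R) (T : H1 -> H2) : unitary_op T ->
  exists T' : H2 -> H1, [/\ unitary_op T', cancel T T' & cancel T' T].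
Proof.
move=> uT; have [T1 T2 /choice[T' TT']] := uT; have Tinj := unitary_op_inj uT.
have T'T : cancel T T' by move=> v; apply: Tinj; rewrite TT'.
exists T'; split=> //; split=> [a u v|u v|w].
- by apply: Tinj; rewrite T1 !TT'.
- by rewrite -T2 !TT'.
- by exists (T w).
Qed.

Variables (G : groupType) (K : set G).

Lemma unitarily_equivalent_refl (H : hilbert R) (pi : urep K H) :
  unitarily_equivalent pi pi.
Proof. by exists id => //; split=> // w; exists w. Qed.

Lemma unitarily_equivalent_sym (H1 H2 : hilbert R)
    (pi1 : urep K H1) (pi2 : urep K H2) :
  unitarily_equivalent pi1 pi2 -> unitarily_equivalent pi2 pi1.
Proof.
move=> [T uT Tpi]; have [T' [uT' TT' T'T]] := unitary_op_inv uT.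
by exists T' => // x v Kx; rewrite -[v in LHS]T'T -Tpi// TT'.
Qed.

Lemma unitarily_equivalent_trans (H1 H2 H3 : hilbert R)
    (pi1 : urep K H1) (pi2 : urep K H2) (pi3 : urep K H3) :
  unitarily_equivalent pi1 pi2 -> unitarily_equivalent pi2 pi3 ->
  unitarily_equivalent pi1 pi3.
Proof.
move=> [T [T1 T2 T3] Tpi] [S [S1 S2 S3] Spi]; exists (S \o T) => [|x v Kx /=].
  split=> [a u v|u v|w] /=; [by rewrite T1 S1|by rewrite S2 T2|].
  by have [v <-] := S3 w; have [u <-] := T3 v; exists u.
by rewrite Tpi// Spi.
Qed.

End Equivalence.

(** * The group algebra and its C*-completion *)

Section GroupAlgebra.
Variables (R : realType) (G : groupType).
Local Notation C := R[i].
Implicit Types (f h : G -> C).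
Local Notation ga := (@group_algebra R G).

Definition fsupport (A : {fset G}) f : Prop := forall x, x \notin A -> f x = 0.

Lemma group_algebraP f : ga f <-> exists A, fsupport A f.
Proof.
split=> [fF|[A Af]].
  exists (fset_set [set x | f x != 0]) => x.
  by rewrite in_fset_set//= notin_setE/= => /negP; rewrite negbK => /eqP.
apply: sub_finite_set (finite_fset A) => x /=; apply: contra_neqT => /Af //.
Qed.

Lemma fsupportS (A B : {fset G}) f : (A `<=` B)%fset -> fsupport A f ->
  fsupport B f.
Proof.
move=> AB Af x xB; apply: Af; apply: contraNN xB.
by move/fsubsetP: AB; apply.
Qed.

Lemma group_algebra_delta y : ga (fun x => (x == y)%:R).
Proof.
apply/group_algebraP; exists [fset y]%fset => x.
by rewrite inE => /negbTE ->.
Qed.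

Lemma group_algebraZ a f : ga f -> ga (a *: f).
Proof.
move=> /group_algebraP[A Af]; apply/group_algebraP; exists A => x /Af fx.
by rewrite -[LHS]/(a * f x) fx mulr0.
Qed.

Lemma group_algebraD f h : ga f -> ga h -> ga (f + h).
Proof.
move=> /group_algebraP[A Af] /group_algebraP[B Bh]; apply/group_algebraP.
exists (A `|` B)%fset => x; rewrite inE negb_or => /andP[/Af fx /Bh hx].
by rewrite -[LHS]/(f x + h x) fx hx addr0.
Qed.

Lemma group_algebraB f h : ga f -> ga h -> ga (f - h).
Proof.
by move=> fF hF; apply: group_algebraD => //; rewrite -scaleN1r;
  exact: group_algebraZ.
Qed.

Definition conv f h : G -> C :=
  fun x => \sum_(y \in [set: G]) f y * h (y^-1 * x)%g.

Lemma convE (A : {fset G}) f h x : fsupport A f ->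
  conv f h x = \sum_(y <- A) f y * h (y^-1 * x)%g.
Proof. by move=> Af; apply: fsbigTE => y /Af ->; rewrite mul0r. Qed.

Lemma fsupport_conv (A B : {fset G}) f h : fsupport A f -> fsupport B h ->
  fsupport [fset (a * b)%g | a in A, b in B]%fset (conv f h).
Proof.
move=> Af Bh x xAB; rewrite (convE _ _ Af) big_seq big1// => y yA.
rewrite Bh ?mulr0//; apply: contraNN xAB => yxB.
by apply/imfset2P; exists y => //; exists (y^-1 * x)%g => //; rewrite mulKVg.
Qed.

Lemma group_algebra_conv f h : ga f -> ga h -> ga (conv f h).
Proof.
move=> /group_algebraP[A Af] /group_algebraP[B Bh]; apply/group_algebraP.
by exists [fset (a * b)%g | a in A, b in B]%fset; exact: fsupport_conv.
Qed.

Section Integrated.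
Variables (H : hilbert R) (pi : urep [set: G] H).
Implicit Types (v : H).

Lemma integratedE (A : {fset G}) f v : fsupport A f ->
  integrated pi f v = \sum_(x <- A) f x *: pi x v.
Proof. by move=> Af; apply: fsbigTE => x /Af ->; rewrite scale0r. Qed.

Lemma integrated_delta y v : integrated pi (fun x => (x == y)%:R) v = pi y v.
Proof.
rewrite (@integratedE [fset y]%fset) => [|x]; last by rewrite inE => /negbTE ->.
by rewrite big_seq_fset1 eqxx scale1r.
Qed.

Lemma integrated_lin f h a v : ga f -> ga h ->
  integrated pi (a *: f + h) v = a *: integrated pi f v + integrated pi h v.
Proof.
move=> /group_algebraP[A Af] /group_algebraP[B Bh].
have Af' := fsupportS (fsubsetUl A B) Af;
  have Bh' := fsupportS (fsubsetUr A B) Bh.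
rewrite (integratedE _ Af') (integratedE _ Bh') (@integratedE (A `|` B)%fset).
  rewrite scaler_sumr -big_split/=; apply: eq_bigr => x _.
  by rewrite -[(_ + _) x]/(a * f x + h x) scalerDl scalerA.
by move=> x xAB; rewrite -[LHS]/(a * f x + h x) Af'// Bh'// mulr0 addr0.
Qed.

Lemma integrated0 v : integrated pi 0 v = 0.
Proof. by rewrite (@integratedE fset0)// big_nil. Qed.

Lemma integratedZ f a v : ga f ->
  integrated pi (a *: f) v = a *: integrated pi f v.
Proof.
move=> fF; rewrite -[a *: f]addr0 integrated_lin ?integrated0 ?addr0//.
by apply/group_algebraP; exists fset0.
Qed.

Lemma integratedD f h v : ga f -> ga h ->
  integrated pi (f + h) v = integrated pi f v + integrated pi h v.
Proof. by move=> fF hF; rewrite -[f]scale1r integrated_lin// !scale1r. Qed.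

Lemma integratedB f h v : ga f -> ga h ->
  integrated pi (f - h) v = integrated pi f v - integrated pi h v.
Proof. move=> fF hF; have -> : f - h = -1 *: h + f by rewrite scaleN1r addrC.
by rewrite integrated_lin// scaleN1r addrC.
Qed.

Lemma integrated_linear f a u v : ga f ->
  integrated pi f (a *: u + v) = a *: integrated pi f u + integrated pi f v.
Proof.
move=> /group_algebraP[A Af];
  rewrite !(integratedE _ Af) scaler_sumr -big_split/=.
apply: eq_bigr => x _; rewrite urepD// urepZ// scalerDr !scalerA.
by rewrite mulrC.
Qed.

Lemma integrated_vZ f a v : ga f ->
  integrated pi f (a *: v) = a *: integrated pi f v.
Proof.
move=> /group_algebraP[A Af]; rewrite !(integratedE _ Af) scaler_sumr.
by apply: eq_bigr => x _; rewrite urepZ// !scalerA mulrC.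
Qed.

Lemma integrated_conv f h v : ga f -> ga h ->
  integrated pi (conv f h) v = integrated pi f (integrated pi h v).
Proof.
move=> /group_algebraP[A Af] /group_algebraP[B Bh].
pose AB := [fset (a * b)%g | a in A, b in B]%fset.
rewrite (integratedE _ (fsupport_conv Af Bh)) -/AB (integratedE _ Af).
under eq_bigr do rewrite (convE _ _ Af) scaler_suml.
rewrite exchange_big/= big_seq [RHS]big_seq; apply: eq_bigr => y yA.
under eq_bigr do rewrite -scalerA.
rewrite -scaler_sumr; congr (_ *: _).
have yh x : x \notin AB -> h (y^-1 * x)%g *: pi x v = 0.
  move=> xAB; rewrite Bh ?scale0r//; apply: contraNN xAB => yxB.
  by apply/imfset2P; exists y => //; exists (y^-1 * x)%g => //; rewrite mulKVg.
(* The sum over the set of products is extended to all of G, translated by [y], and cut back to the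
   support [B] of [h]. *)
rewrite -(fsbigTE _ _ yh) (reindex_fsbigT (mulg y)); last first.
  by exists (mulg y^-1%g) => x; rewrite ?mulKg ?mulKVg.
rewrite (integratedE _ Bh) urep_sum// -(@fsbigTE _ _ _ _ B); last first.
  by move=> z /Bh ->; rewrite scale0r urep0.
by apply: eq_fsbigr => z _; rewrite mulKg urepM// urepZ.
Qed.

(** The l^1 norm of [f] works in every representation at once; this makes the suprema in [rep_norm]
    and [cstar_norm] finite. *)
Lemma integrated_bounded f : ga f ->
  exists2 c : R, 0 <= c & forall (H' : hilbert R) (pi' : urep [set: G] H')
    (v : H'), hnorm (integrated pi' f v) <= c * hnorm v.
Proof.
move=> /group_algebraP[A Af]; exists (\sum_(x <- A) normc (f x)).
  by apply: sumr_ge0 => x _; exact: normc_ge0.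
move=> H' pi' v; rewrite [integrated _ _ _](@fsbigTE _ _ _ _ A); last first.
  by move=> x /Af ->; rewrite scale0r.
apply: le_trans (hnorm_sum _ _) _; rewrite mulr_suml; apply: ler_sum => x _.
by rewrite hnormZ urep_norm.
Qed.

End Integrated.

Lemma integrated_intertwine (H1 H2 : hilbert R) (pi1 : urep [set: G] H1)
    (pi2 : urep [set: G] H2) (T : H1 -> H2) f v :
  ga f -> linear T -> (forall x v, T (pi1 x v) = pi2 x (T v)) ->
  T (integrated pi1 f v) = integrated pi2 f (T v).
Proof.
move=> /group_algebraP[A Af] Tlin Tpi; rewrite !(integratedE _ _ Af).
have T0 : T 0 = 0.
  by have := Tlin (-1) 0 0; rewrite !scaleN1r oppr0 addr0 addNr.
elim: (enum_fset A) => [|x s IHs]; first by rewrite !big_nil.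
by rewrite !big_cons Tlin IHs Tpi.
Qed.

End GroupAlgebra.

Section CstarNorm.
Variables (R : realType) (G : groupType).
Implicit Types (f h : G -> R[i]).
Local Notation ga := (@group_algebra R G).

Lemma rep_norm_ub (H : hilbert R) (pi : urep [set: G] H) f (c : R) :
  (forall v, hnorm (integrated pi f v) <= c * hnorm v) -> 0 <= c ->
  rep_norm pi f <= c.
Proof.
move=> fc c0; apply: sup_le_ub.
  by exists (hnorm (integrated pi f 0)); exists 0 => //=; rewrite hnorm0.
move=> _ [v /= v1 <-]; apply: le_trans (fc v) _.
by rewrite -[leRHS]mulr1 ler_wpM2l.
Qed.

Lemma cstar_norm_ub f (c : R) : 0 <= c ->
  (forall (H : hilbert R) (pi : urep [set: G] H) v,
    hnorm (integrated pi f v) <= c * hnorm v) ->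
  cstar_norm f <= c.
Proof.
move=> c0 fc; rewrite /cstar_norm; set S := (X in sup X).
(* The supremum of the empty set is 0, so no representation has to be exhibited. *)
have [S0|/set0P S0] := eqVneq S set0; first by rewrite S0 sup0.
by apply: sup_le_ub => // _ [H [pi ->]]; apply: rep_norm_ub.
Qed.

Lemma rep_norm_le (H : hilbert R) (pi : urep [set: G] H) f v :
  ga f -> hnorm v <= 1 -> hnorm (integrated pi f v) <= rep_norm pi f.
Proof.
move=> /integrated_bounded[c c0 fc] v1; apply: ub_le_sup; last by exists v.
exists c => _ [w /= w1 <-]; apply: le_trans (fc _ _ w) _.
by rewrite -[leRHS]mulr1 ler_wpM2l.
Qed.

Lemma rep_norm_le_cstar (H : hilbert R) (pi : urep [set: G] H) f :
  ga f -> rep_norm pi f <= cstar_norm f.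
Proof.
move=> /integrated_bounded[c c0 fc]; apply: ub_le_sup; last by exists H, pi.
by exists c => _ [H' [pi' ->]]; exact: rep_norm_ub.
Qed.

Lemma cstar_norm_ge0 f : ga f -> 0 <= cstar_norm f.
Proof.
move=> fF; have [S0|/set0P[_ [H [pi _]]]] := eqVneq
    [set x | exists (H : hilbert R) (pi : urep [set: G] H), x = rep_norm pi f]
    set0.
  by rewrite /cstar_norm S0 sup0.
apply: le_trans (rep_norm_le_cstar pi fF).
by apply: le_trans (rep_norm_le pi (v := 0) fF _); rewrite ?hnorm0 ?hnorm_ge0.
Qed.

Lemma cstar_norm_le (H : hilbert R) (pi : urep [set: G] H) f v : ga f ->
  hnorm (integrated pi f v) <= cstar_norm f * hnorm v.
Proof.
move=> fF; apply: le_trans (ler_wpM2r (hnorm_ge0 v) (rep_norm_le_cstar pi fF)).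
have [->|v0] := eqVneq v 0.
  have [c c0 fc] := integrated_bounded fF.
  by have := fc H pi 0; rewrite hnorm0 !mulr0.
have vn : hnorm v != 0 by apply: contraNneq v0 => /hnorm_eq0 ->.
have v_gt0 : 0 < hnorm v by rewrite lt_def vn hnorm_ge0.
have nv : normc (((hnorm v)^-1)%:C)%C = (hnorm v)^-1.
  by rewrite normc_real ger0_norm ?invr_ge0 ?hnorm_ge0.
rewrite -ler_pdivrMr// mulrC -nv -hnormZ -integrated_vZ//.
by apply: rep_norm_le; rewrite ?hnormZ ?nv ?mulVf.
Qed.

Lemma cstar_norm0 : cstar_norm (0 : G -> R[i]) = 0.
Proof.
apply/eqP; rewrite eq_le cstar_norm_ge0 ?andbT.
  by apply: cstar_norm_ub => // H pi v; rewrite integrated0 hnorm0 mul0r.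
by apply/group_algebraP; exists fset0.
Qed.

End CstarNorm.

(** * Kernels in C*(G) and convergence in the dual *)

Section Kernels.
Variables (R : realType) (G : groupType).
Implicit Types (f h : G -> R[i]) (a : cstar R G).
Local Notation ga := (@group_algebra R G).

Lemma cstar_class_cauchy a u : cstar_class a u -> cstar_cauchy u.
Proof. by case: (cstarP a) => u' _ -> []. Qed.

(** [M] is chosen before the representation: the C*-norm of u j - u i bounds it in all of them, and
    the dependence of i on [pi] and [v] disappears from the estimate. *)
Lemma rep_kernel_bound a u (e : R) : cstar_class a u -> 0 < e ->
  exists M, forall j, (M <= j)%N ->
    forall (H : hilbert R) (pi : urep [set: G] H) (v : H), rep_kernel pi a ->
    hnorm (integrated pi (u j) v) <= e * hnorm v.
Proof.
move=> au e0; have [ugr /(_ e e0)[M uM]] := cstar_class_cauchy au.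
exists M => j Mj H pi v /(_ u au v)/hcvgP piu.
apply/ler_addgt0Pl => d d0.
have [k _ kP] := piu d d0.
have := kP (maxn k M) (leq_maxl _ _); set i := maxn k M.
rewrite subr0 => /ltW uid.
have -> : integrated pi (u j) v =
  integrated pi (u i) v + integrated pi (u j - u i) v.
  by rewrite integratedB// addrC subrK.
apply: le_trans (hnormD _ _) _; apply: lerD => //.
apply: le_trans (cstar_norm_le _ _ _) _; first exact: group_algebraB.
apply: ler_wpM2r; first exact: hnorm_ge0.
by apply/ltW/uM => //; exact: leq_maxr.
Qed.

Section CstarOf.
Variables (u : nat -> G -> R[i]) (uC : cstar_cauchy u).

Definition cstar_of : cstar R G :=
  Cstar (ex_intro2 _ _ u uC (erefl [set w | cstar_cauchy w /\
                     cstar_norm (w k - u k) @[k --> \oo] --> (0 : R)])).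

(** One representative suffices: any other differs from it by a sequence that is null in the
    C*-norm, hence null in [pi]. *)
Lemma rep_kernel_cstar_of (H : hilbert R) (pi : urep [set: G] H) :
  (forall v, hcvg (fun k => integrated pi (u k) v) 0) -> rep_kernel pi cstar_of.
Proof.
move=> piu w [[wgr _] wu] v; apply/hcvgP => e e0.
have d0 : 0 < e / 2 by rewrite divr_gt0.
have c0 : 0 < e / 2 / (1 + hnorm v).
  by rewrite divr_gt0// ltr_pwDl// hnorm_ge0.
have /hcvgP/(_ _ d0) := piu v; move/cvgrPdist_lt/(_ _ c0): wu.
apply: filterS2 => k; rewrite sub0r normrN !subr0 => wuk uk.
have -> : integrated pi (w k) v =
  integrated pi (u k) v + integrated pi (w k - u k) v.
  by rewrite integratedB; [rewrite addrC subrK|exact: wgr|exact: uC.1].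
apply: le_lt_trans (hnormD _ _) _; rewrite [ltRHS]splitr; apply: ltr_leD => //.
apply: le_trans (cstar_norm_le _ _ _) _.
  by apply: group_algebraB; [exact: wgr|exact: uC.1].
apply: (@le_trans _ _ (e / 2 / (1 + hnorm v) * (1 + hnorm v))); last first.
  by rewrite divfK// gt_eqF// ltr_pwDl// hnorm_ge0.
apply: ler_pM; rewrite ?hnorm_ge0//; last by rewrite lerDr.
  by apply: cstar_norm_ge0; apply: group_algebraB; [exact: wgr|exact: uC.1].
by apply: le_trans (ltW wuk); exact: ler_norm.
Qed.

Lemma cvg_of_rep_kernel (H : hilbert R) (pi : urep [set: G] H) :
  rep_kernel pi cstar_of -> forall v, hcvg (fun k => integrated pi (u k) v) 0.
Proof.
apply; split=> //; under eq_fun do rewrite subrr cstar_norm0.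
exact: cvg_cst.
Qed.

End CstarOf.

(** [T] is only isometric, so this covers the inclusion of a subrepresentation, whose kernel can
    only grow. *)
Lemma rep_kernelS (H1 H2 : hilbert R) (pi1 : urep [set: G] H1)
    (pi2 : urep [set: G] H2) (T : H1 -> H2) :
  linear T -> (forall v, hnorm (T v) = hnorm v) ->
  (forall x v, T (pi1 x v) = pi2 x (T v)) -> rep_kernel pi2 `<=` rep_kernel pi1.
Proof.
move=> Tlin Tn Tpi a a2 u au v; have [ugr _] := cstar_class_cauchy au.
apply/hcvgP => e /((hcvgP _ _).1 (a2 u au (T v))); apply: filterS => k.
by rewrite !subr0 -(integrated_intertwine v (ugr k) Tlin Tpi) Tn.
Qed.

Lemma rep_kernel_equiv (H1 H2 : hilbert R) (pi1 : urep [set: G] H1)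
    (pi2 : urep [set: G] H2) :
  unitarily_equivalent pi1 pi2 -> rep_kernel pi1 = rep_kernel pi2.
Proof.
move=> pi12.
have S (H H' : hilbert R) (pi : urep [set: G] H) (pi' : urep [set: G] H') :
    unitarily_equivalent pi pi' -> rep_kernel pi' `<=` rep_kernel pi.
  move=> [T uT Tpi]; apply: (rep_kernelS (T := T)) => [|v|x v].
  - by case: uT.
  - exact: unitary_op_norm.
  - exact: Tpi.
by apply/seteqP; split; apply: S => //; exact: unitarily_equivalent_sym.
Qed.

Lemma dual_kernelE (x : dual R [set: G]) (pi : irrep R [set: G]) :
  dual_class x pi -> dual_kernel x = rep_kernel pi.
Proof.
move=> xpi; apply/seteqP; split=> [a|a api pi']; first exact.
case: (dualP x) xpi => pi0 -> pi01 pi02.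
by rewrite -(rep_kernel_equiv pi02) (rep_kernel_equiv pi01).
Qed.

Lemma dual_kernel_iclass (pi : irrep R [set: G]) :
  dual_kernel (iclass pi) = rep_kernel pi.
Proof. by apply: dual_kernelE; exact: unitarily_equivalent_refl. Qed.

Lemma dual_kernel_primitive (x : dual R [set: G]) : primitive (dual_kernel x).
Proof.
have [pi xpi] := dualP x; exists pi; apply: dual_kernelE.
by rewrite xpi; exact: unitarily_equivalent_refl.
Qed.

(** If [p] leaves an open set around [pi] infinitely often, the kernels at these indices all lie in
    the closed complement [Z]; the inclusion for this infinite set then puts ker pi into [Z] as
    well. *)
Lemma dual_cvgI (p : nat -> dual R [set: G]) (pi : irrep R [set: G]) :
  (forall A : set nat, (forall M, exists2 k, (M <= k)%N & A k) ->
    \bigcap_(k in A) dual_kernel (p k) `<=` rep_kernel pi) ->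
  dual_cvg p (iclass pi).
Proof.
move=> piP U [Z [Zpr Zcl] UZ] /UZ Upi.
apply: contrapT => nU; apply: Upi; rewrite dual_kernel_iclass.
apply: Zcl => [|a Za]; first by exists pi.
apply: (piP [set k | Z (dual_kernel (p k))]) => [M|k Zk]; last exact: Za.
apply: contrapT => nM; apply: nU; exists M => // k /= Mk; apply/UZ => Zk.
by apply: nM; exists k.
Qed.

(** The hull [Z] of the tail intersection is closed. If ker pi were outside it, the complement would
    be a neighbourhood of [pi] that no [p k] with k >= M enters. *)
Lemma dual_cvg_kernel (p : nat -> dual R [set: G]) (pi : irrep R [set: G]) M :
  dual_cvg p (iclass pi) ->
  \bigcap_(k in [set k | (M <= k)%N]) dual_kernel (p k) `<=` rep_kernel pi.
Proof.
move=> ppi.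
pose I := \bigcap_(k in [set k | (M <= k)%N]) dual_kernel (p k).
pose Z : set (set (cstar R G)) := [set P | primitive P /\ I `<=` P].
have Zcl : jacobson_closed Z.
  split=> [P []//|P Ppr ZP]; split=> // a Ia; apply: ZP => Q [_]; exact.
apply: contrapT => nI.
have [] := ppi (fun x => ~ Z (dual_kernel x)).
- by exists Z.
- by rewrite dual_kernel_iclass => -[].
move=> k _ /(_ (maxn k M) (leq_maxl _ _)); apply; split.
  exact: dual_kernel_primitive.
by move=> a; apply; exact: leq_maxr.
Qed.

End Kernels.

Lemma normc_half (R : realType) : normc (2^-1 : R[i]) = 2^-1.
Proof.
rewrite normcV; congr (_^-1); apply: (@complexI R).
by rewrite -normCE normr_nat rmorph_nat.
Qed.

Lemma halfC (R : realType) : (2^-1 : R[i]) = (2^-1)%:C%C.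
Proof. by rewrite fmorphV rmorph_nat. Qed.

(** * Truncation by square roots *)

Section SquareRootIteration.
Variable R : realType.

(* sqrt_op n is obtained from the polynomial iteration for 1 - sqrt (1 - s) at
   s = 1 - T^2, so it tends to 1 - |T|; the scalar sequence is the value at
   s = 1, and dominates the operators because all coefficients are
   nonnegative. *)
Fixpoint sqrt_majorant (n : nat) : R :=
  if n is m.+1 then 2^-1 * (1 + sqrt_majorant m ^+ 2) else 0.
Local Notation c := sqrt_majorant.

Lemma sqrt_majorant_itv n : 0 <= c n <= 1.
Proof. by elim: n => [|n IHn] /=; [rewrite lexx ler01|nra]. Qed.

Lemma sqrt_majorantS n : c n <= c n.+1.
Proof.
elim: n => [|n /=]; first by rewrite /= expr0n addr0 mulr1 invr_ge0.
have := sqrt_majorant_itv n; set x := c n; nra.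
Qed.

(** Used to make [sqrt_op] Cauchy at a rate that depends neither on the operator nor on the Hilbert
    space. *)
Lemma sqrt_majorant_cvg : cvgn c.
Proof.
apply: nondecreasing_is_cvgn; first exact/nondecreasing_seqP/sqrt_majorantS.
by exists 1 => _ [n _ <-]; have /andP[] := sqrt_majorant_itv n.
Qed.

Variables (H : hilbert R) (T : H -> H).
Hypothesis Tlin : linear T.
Hypothesis T1 : forall v, hnorm (v - T (T v)) <= hnorm v.

Fixpoint sqrt_op (n : nat) (v : H) : H :=
  if n is m.+1 then 2^-1 *: ((v - T (T v)) + sqrt_op m (sqrt_op m v)) else 0.
Local Notation W := sqrt_op.

Let TD u v : T (u + v) = T u + T v.
Proof. by have := Tlin 1 u v; rewrite !scale1r. Qed.

Let T0 : T 0 = 0.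
Proof. by apply: (addrI (T 0)); rewrite -TD !addr0. Qed.

Let TZ a v : T (a *: v) = a *: T v.
Proof. by have := Tlin a v 0; rewrite !addr0 T0 addr0. Qed.

Let TB u v : T (u - v) = T u - T v.
Proof. by rewrite TD -[in LHS]scaleN1r TZ scaleN1r. Qed.

Lemma sqrt_op_lin n : linear (W n).
Proof.
elim: n => [|n IHn] a u v /=; first by rewrite scaler0 addr0.
rewrite !IHn !Tlin scalerA [a * _]mulrC -scalerA -scalerDr; congr (_ *: _).
rewrite scalerDr scalerBr !opprD !addrA.
rewrite -!addrA; congr (_ + _); rewrite !addrA; congr (_ + _).
rewrite [in RHS]addrAC -!addrA; rewrite addrCA; congr (_ + _).
by rewrite addrA [in LHS](addrC v) addrC.
Qed.

Let WD n u v : W n (u + v) = W n u + W n v.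
Proof. by have := sqrt_op_lin n 1 u v; rewrite !scale1r. Qed.

Let WB n u v : W n (u - v) = W n u - W n v.
Proof.
have -> : u - v = -1 *: v + u by rewrite scaleN1r addrC.
by rewrite sqrt_op_lin scaleN1r addrC.
Qed.

Lemma sqrt_op_comm n v : T (W n v) = W n (T v).
Proof.
by elim: n v => [|n IHn] v /=; rewrite ?T0// TZ TD TB !IHn.
Qed.

Lemma sqrt_op_le n v : hnorm (W n v) <= c n * hnorm v.
Proof.
elim: n v => [|n IHn] v /=; first by rewrite hnorm0 mul0r.
rewrite hnormZ normc_half -mulrA ler_pM2l ?invr_gt0//.
apply: le_trans (hnormD _ _) _; rewrite mulrDl mul1r lerD// expr2 -mulrA.
by apply: le_trans (IHn _) _; rewrite ler_wpM2l//;
  have /andP[] := sqrt_majorant_itv n.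
Qed.

(** Writing W' for [W n.+1], the difference of squares splits as W' (W' - W) + (W' - W) W; the
    majorant obeys the same identity, so the bounds propagate factor by factor. *)
Lemma sqrt_opS n v : hnorm (W n.+1 v - W n v) <= (c n.+1 - c n) * hnorm v.
Proof.
elim: n v => [|n IHn] v.
  rewrite /= !subr0 addr0 expr0n addr0 mulr1 hnormZ normc_half.
  by rewrite ler_pM2l ?invr_gt0.
set W' := W n.+1; set c' := c n.+1; rewrite -/W' -/c' in IHn.
have -> : W n.+2 v - W' v =
    2^-1 *: (W' (W' v - W n v) + (W' (W n v) - W n (W n v))).
  rewrite [W' (_ - _)]WB addrA subrK.
  rewrite -[W n.+2 v]/(2^-1 *: ((v - T (T v)) + W' (W' v))).
  rewrite -[X in _ - X]/(2^-1 *: ((v - T (T v)) + W n (W n v))) -scalerBr.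
  by congr (_ *: _); rewrite opprD addrACA subrr add0r.
have -> : c n.+2 - c' = 2^-1 * (c' * (c' - c n) + (c' - c n) * c n).
  rewrite -[c n.+2]/(2^-1 * (1 + c' ^+ 2)).
  rewrite -[X in _ - X]/(2^-1 * (1 + c n ^+ 2)).
  ring.
rewrite hnormZ normc_half -mulrA ler_pM2l ?invr_gt0//.
have /andP[c'0 _] := sqrt_majorant_itv n.+1.
have cc : 0 <= c' - c n by rewrite subr_ge0 sqrt_majorantS.
rewrite mulrDl; apply: le_trans (hnormD _ _) _; apply: lerD.
  apply: le_trans (sqrt_op_le n.+1 _) _; rewrite -mulrA ler_wpM2l//.
apply: le_trans (IHn _) _; rewrite -mulrA ler_wpM2l//; exact: sqrt_op_le.
Qed.

Lemma sqrt_op_sub m n v : (n <= m)%N ->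
  hnorm (W m v - W n v) <= (c m - c n) * hnorm v.
Proof.
move=> /subnK <-; elim: (m - n)%N => [|k IHk].
  by rewrite add0n !subrr hnorm0 mul0r.
have -> : W (k.+1 + n) v - W n v =
    (W (k.+1 + n) v - W (k + n) v) + (W (k + n) v - W n v).
  by rewrite addrA subrK.
apply: le_trans (hnormD _ _) _; apply: le_trans (lerD (sqrt_opS _ _) IHk) _.
by rewrite -mulrDl addrA subrK.
Qed.

(* 2 ((1 + T) - W (n + 1)) = ((1 + T) + W n) ((1 + T) - W n), and W n commutes
   with T. *)
Lemma sqrt_op_decay (d : R) n v : 0 <= d <= 1 ->
  (forall w, hnorm (w + T w) <= (1 - d) * hnorm w) ->
  hnorm (v + T v - W n v) <= (1 - d / 2) ^+ n * hnorm v.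
Proof.
move=> d01 Td; elim: n v => [|n IHn] v.
  rewrite subr0 expr0 mul1r; apply: le_trans (Td v) _.
  rewrite -[leRHS]mul1r ler_wpM2r ?hnorm_ge0//; lra.
pose A u := u + T u.
have WA u : A (W n u) = W n (A u) by rewrite /A sqrt_op_comm -WD.
have AD u w : A (u - w) = A u - A w.
  by rewrite /A TB opprD addrACA.
have -> : v + T v - W n.+1 v =
    2^-1 *: (A (A v - W n v) + W n (A v - W n v)).
  have half w : 2^-1 *: (w + w) = w :> H.
    rewrite -[in LHS](scale1r w) -scalerDl scalerA mulVf ?scale1r//.
    by rewrite pnatr_eq0.
  rewrite AD WB WA addrA subrK /= -[v + T v]half.
  rewrite -scalerBr; congr (_ *: _); rewrite opprD addrA; congr (_ - _).
  rewrite /A TD opprB -addrA; congr (_ + _).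
  by rewrite (addrC v) (addrC (T (T v))) addrA addrK.
rewrite hnormZ normc_half exprS -mulrA.
have -> : (1 - d / 2) * ((1 - d / 2) ^+ n * hnorm v) =
  2^-1 * ((1 - d) * ((1 - d / 2) ^+ n * hnorm v) + (1 - d / 2) ^+ n * hnorm v).
  by field.
rewrite ler_pM2l ?invr_gt0//.
apply: le_trans (hnormD _ _) _; apply: lerD.
  by apply: le_trans (Td _) _; rewrite ler_wpM2l ?IHn//; lra.
apply: le_trans (sqrt_op_le _ _) _; apply: le_trans _ (IHn v).
rewrite -[leRHS]mul1r ler_wpM2r ?hnorm_ge0//.
by have /andP[] := sqrt_majorant_itv n.
Qed.

End SquareRootIteration.

(** * An element of C*(G) that detects whether |f v|^2 <= eps |v|^2 *)

Section KernelElement.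
Variables (R : realType) (G : groupType).
Local Notation ga := (@group_algebra R G).

(** The involution is specified by its effect in all representations, which is all that the
    estimates use, instead of by a formula on the group. *)
Definition adjoint_pair (f f' : G -> R[i]) : Prop :=
  forall (H : hilbert R) (pi : urep [set: G] H) (u v : H),
    hdot H (integrated pi f u) v = hdot H u (integrated pi f' v).

Definition contractive (f : G -> R[i]) : Prop :=
  forall (H : hilbert R) (pi : urep [set: G] H) (v : H),
    hnorm (integrated pi f v) <= hnorm v.

Lemma adjoint_pairC f f' : adjoint_pair f f' -> adjoint_pair f' f.
Proof. by move=> ff' H pi u v; rewrite hdotC -ff' -hdotC. Qed.

(** For w = f' v one has |w|^2 = <f w, v> <= c |w| |v|. *)
Lemma adjoint_le f f' (H : hilbert R) (pi : urep [set: G] H) (c : R) :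
  adjoint_pair f f' -> 0 <= c ->
  (forall v, hnorm (integrated pi f v) <= c * hnorm v) ->
  forall v, hnorm (integrated pi f' v) <= c * hnorm v.
Proof.
move=> ff' c0 fc v; set w := integrated pi f' v.
have ww : hnorm w ^+ 2 <= c * hnorm w * hnorm v.
  have -> : hnorm w ^+ 2 = complex.Re (hdot H w w) by rewrite hdot_sqr.
  rewrite {2}/w -ff'; apply: le_trans (Re_le_normc _) _.
  apply: le_trans (hdot_le _ _) _; apply: ler_wpM2r; first exact: hnorm_ge0.
  exact: fc.
have [w0|w0] := eqVneq (hnorm w) 0; first by rewrite w0 mulr_ge0// hnorm_ge0.
have w_gt0 : 0 < hnorm w by rewrite lt_def w0 hnorm_ge0.
by rewrite -(ler_pM2l w_gt0) -expr2; apply: le_trans ww _; rewrite mulrCA mulrA.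
Qed.

Variables (f f' : G -> R[i]) (eps : R).
Hypotheses (fF : ga f) (f'F : ga f') (ff' : adjoint_pair f f').
Hypotheses (fc : contractive f) (eps01 : 0 < eps <= 1).

Let one : G -> R[i] := fun x => (x == 1%g)%:R.
(** The factor 1/2 makes T a contraction, since f' f and eps both have norm at most 1. *)
Let T := 2^-1 *: (conv f' f - eps%:C%C *: one).

Fixpoint sqrt_seq (n : nat) : G -> R[i] :=
  if n is m.+1
  then 2^-1 *: ((one - conv T T) + conv (sqrt_seq m) (sqrt_seq m)) else 0.

(* Tends to T + |T| for T = (f^* f - eps) / 2. *)
Definition kernel_seq n : G -> R[i] := one + T - sqrt_seq n.

Let oneF : ga one. Proof. exact: group_algebra_delta. Qed.

Let TF : ga T.
Proof.
apply: group_algebraZ; apply: group_algebraB; first exact: group_algebra_conv.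
exact: group_algebraZ.
Qed.

Let sqrt_seqF n : ga (sqrt_seq n).
Proof.
elim: n => [|n IHn] /=; first by apply/group_algebraP; exists fset0.
apply: group_algebraZ; apply: group_algebraD; last exact: group_algebra_conv.
by apply: group_algebraB => //; exact: group_algebra_conv.
Qed.

Let kernel_seqF n : ga (kernel_seq n).
Proof. by apply: group_algebraB => //; exact: group_algebraD. Qed.

Section InRep.
Variables (H : hilbert R) (pi : urep [set: G] H).
Local Notation ipi := (integrated pi).

Let ione v : ipi one v = v.
Proof. by rewrite integrated_delta urep1. Qed.

Let iT v : ipi T v = 2^-1 *: (ipi f' (ipi f v) - eps%:C%C *: v).
Proof.
rewrite integratedZ; last first.
  apply: group_algebraB; first exact: group_algebra_conv.
  exact: group_algebraZ.
rewrite integratedB; [|exact: group_algebra_conv|exact: group_algebraZ].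
by rewrite integrated_conv// integratedZ// ione.
Qed.

Let iTlin : linear (ipi T).
Proof. by move=> a u v; exact: integrated_linear. Qed.

Let isqrt n v : ipi (sqrt_seq n) v = sqrt_op (ipi T) n v.
Proof.
elim: n v => [|n IHn] v /=; first by rewrite integrated0.
have gaTT : ga (one - conv T T).
  by apply: group_algebraB => //; exact: group_algebra_conv.
rewrite integratedZ; last by apply: group_algebraD => //;
  exact: group_algebra_conv.
rewrite integratedD//; last exact: group_algebra_conv.
rewrite integratedB//; last exact: group_algebra_conv.
by rewrite ione !integrated_conv// !IHn.
Qed.

Let ikernel n v : ipi (kernel_seq n) v = v + ipi T v - sqrt_op (ipi T) n v.
Proof.
by rewrite integratedB//;
  [rewrite integratedD// ione isqrt|exact: group_algebraD].
Qed.

Let iTsa u v : hdot H (ipi T u) v = hdot H u (ipi T v).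
Proof.
rewrite !iT hdotZl hdotZr hdotBl hdotBr hdotZl hdotZr.
rewrite (adjoint_pairC ff') ff' -[Num.conj eps%:C%C]/(conjc _) conjc_real.
by congr (_ * _); rewrite fmorphV rmorph_nat.
Qed.

Let iTle v : hnorm (ipi T v) <= hnorm v.
Proof.
rewrite iT hnormZ normc_half ler_pdivrMl//.
have /andP[e0 e1] := eps01.
have f'1 w : hnorm (ipi f' w) <= 1 * hnorm w.
  by apply: (adjoint_le ff') => // u; rewrite mul1r; exact: fc.
apply: le_trans (hnormB _ _) _; rewrite hnormZ normc_real gtr0_norm//.
have := f'1 (ipi f v); rewrite mul1r => f'f.
have := le_trans f'f (fc pi v); have := hnorm_ge0 v; nra.
Qed.

(** By self-adjointness |v - T^2 v|^2 = |v|^2 - 2 |T v|^2 + |T^2 v|^2, and |T^2 v| <= |T v|. *)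
Let iT1 v : hnorm (v - ipi T (ipi T v)) <= hnorm v.
Proof.
set w := ipi T (ipi T v).
have wn : hnorm w <= hnorm (ipi T v) by exact: iTle.
rewrite -(@ler_pXn2r _ 2)// ?nnegrE ?hnorm_ge0//.
have -> : hnorm (v - w) ^+ 2 =
    hnorm v ^+ 2 - hnorm (ipi T v) ^+ 2 - (hnorm (ipi T v) ^+ 2 - hnorm w ^+ 2).
  apply: (@complexI R); rewrite -hdot_sqr hdotBl !hdotBr !hdot_sqr.
  by rewrite (iTsa (ipi T v) v) -(iTsa v (ipi T v)) !hdot_sqr !rmorphB.
have := hnorm_ge0 w; have := hnorm_ge0 (ipi T v); nra.
Qed.

Lemma kernel_seq_sub m n v :
  hnorm (ipi (kernel_seq m - kernel_seq n) v) <=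
  `|sqrt_majorant R m - sqrt_majorant R n| * hnorm v.
Proof.
rewrite integratedB// !ikernel opprB addrC addrA subrK.
have sub p k : (k <= p)%N ->
    hnorm (sqrt_op (ipi T) p v - sqrt_op (ipi T) k v) <=
    `|sqrt_majorant R p - sqrt_majorant R k| * hnorm v.
  move=> kp; apply: le_trans (sqrt_op_sub iTlin iT1 v kp) _.
  by rewrite ler_wpM2r ?hnorm_ge0 ?ler_norm.
by have [nm|/ltnW mn] := leqP n m; [rewrite hnormBC|rewrite distrC]; exact: sub.
Qed.

(* Here 1 + T has norm at most 1 - eps / 4 by the triangle inequality. *)
Lemma kernel_seq_small (c : R) : 0 <= c -> c ^+ 2 <= eps / 2 ->
  (forall v, hnorm (ipi f v) <= c * hnorm v) ->
  forall v, hcvg (fun n => ipi (kernel_seq n) v) 0.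
Proof.
move=> c0 ceps fv v; have /andP[e0 e1] := eps01.
have f'v := adjoint_le ff' c0 fv.
have d01 : 0 <= eps / 4 <= 1 by lra.
have Td w : hnorm (w + ipi T w) <= (1 - eps / 4) * hnorm w.
  (* Since |f' f w| <= c^2 |w| <= eps / 2 |w|, the two terms contribute 1 - eps / 2 and eps / 4. *)
  rewrite iT (_ : w + _ =
      (1 - eps / 2)%:C%C *: w + 2^-1 *: ipi f' (ipi f w)); last first.
    rewrite scalerBr scalerA rmorphB/= scalerBl scale1r [in RHS]addrAC -addrA.
    by rewrite [eps / 2]mulrC rmorphM/= -halfC addrC.
  apply: le_trans (hnormD _ _) _; rewrite !hnormZ normc_half normc_real.
  rewrite ger0_norm; last by lra.
  have := le_trans (f'v _) (ler_wpM2l c0 (fv w)); rewrite mulrA -expr2.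
  have := ler_wpM2r (hnorm_ge0 w) ceps; lra.
have c1 : `|1 - eps / 4 / 2| < 1 by rewrite ger0_norm; lra.
have := cvg_geometric (hnorm v) c1 => /cvgrPdist_lt cvg0.
apply/hcvgP => e /cvg0; apply: filterS => n; rewrite sub0r normrN subr0.
apply: le_lt_trans; apply: le_trans (ler_norm _);
  rewrite /geometric/= mulrC ikernel.
exact: sqrt_op_decay.
Qed.

(** The majorant is at most 1, so <W_n v, v> <= |v|^2 and <T v, v> is at most <(1 + T - W_n) v, v>,
    which tends to 0. Hence <T v, v> <= 0, which is the claim by definition of T. *)
Lemma kernel_seq_null : (forall v, hcvg (fun n => ipi (kernel_seq n) v) 0) ->
  forall v, hnorm (ipi f v) ^+ 2 <= eps * hnorm v ^+ 2.
Proof.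
move=> kv v.
have ReT : complex.Re (hdot H (ipi T v) v) =
    (hnorm (ipi f v) ^+ 2 - eps * hnorm v ^+ 2) / 2.
  rewrite iT hdotZl hdotBl hdotZl (adjoint_pairC ff') !hdot_sqr.
  suff -> :
    2^-1 * ((hnorm (ipi f v) ^+ 2)%:C%C - eps%:C%C * (hnorm v ^+ 2)%:C%C) =
    ((hnorm (ipi f v) ^+ 2 - eps * hnorm v ^+ 2) / 2)%:C%C by [].
  rewrite halfC mulrC [RHS]rmorphM; congr (_ * _).
  by rewrite [RHS]rmorphB; congr (_ - _); rewrite [RHS]rmorphM.
suff : complex.Re (hdot H (ipi T v) v) <= 0 by rewrite ReT; lra.
apply/ler_addgt0Pl => e e0; rewrite addr0.
have d0 : 0 < e / (1 + hnorm v) by rewrite divr_gt0// ltr_pwDl// hnorm_ge0.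
have /hcvgP/(_ _ d0)[n _ /(_ n (leqnn n))/=] := kv v.
rewrite subr0 ikernel => nd.
set W := sqrt_op (ipi T) n v in nd.
have Wv : complex.Re (hdot H W v) <= hnorm v ^+ 2.
  apply: le_trans (Re_le_normc _) _; apply: le_trans (hdot_le _ _) _.
  rewrite expr2 ler_wpM2r ?hnorm_ge0//; apply: le_trans (sqrt_op_le iT1 _ _) _.
  rewrite -[leRHS]mul1r ler_wpM2r ?hnorm_ge0//.
  by have /andP[] := sqrt_majorant_itv R n.
have : complex.Re (hdot H (v + ipi T v - W) v) <= e.
  apply: le_trans (Re_le_normc _) _; apply: le_trans (hdot_le _ _) _.
  apply: le_trans (ler_wpM2r (hnorm_ge0 v) (ltW nd)) _.
  have v0 := hnorm_ge0 v.
  by rewrite mulrAC ler_pdivrMr; [nra|lra].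
rewrite hdotBl hdotDl hdot_sqr; move: Wv.
by case: (hdot H W v) (hdot H (ipi T v) v) => [a b] [a' b'] /=; lra.
Qed.

End InRep.

Lemma kernel_seq_cauchy : cstar_cauchy kernel_seq.
Proof.
(* A supremum preserves only weak inequalities; aiming at e / 2, as two errors of e / 4, leaves room
   for the strict one. *)
split=> // e e0; have d0 : 0 < e / 4 by rewrite divr_gt0.
have /cvgrPdist_lt/(_ _ d0)[M _ Mc] := @sqrt_majorant_cvg R.
exists M => j k /Mc/= cj /Mc/= ck.
have cjk : `|sqrt_majorant R j - sqrt_majorant R k| <= e / 2.
  have := ler_distD (lim (sqrt_majorant R @ \oo)) (sqrt_majorant R j)
    (sqrt_majorant R k).
  move/le_trans; apply; rewrite distrC; lra.
apply: (@le_lt_trans _ _ (e / 2)); last by lra.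
apply: cstar_norm_ub => [|H pi v]; first by lra.
by apply: le_trans (kernel_seq_sub _ _ _ _) _; rewrite ler_wpM2r ?hnorm_ge0.
Qed.

Definition kernel_elt : cstar R G := cstar_of kernel_seq_cauchy.

Lemma kernel_eltI (H : hilbert R) (pi : urep [set: G] H) (c : R) :
  0 <= c -> c ^+ 2 <= eps / 2 ->
  (forall v, hnorm (integrated pi f v) <= c * hnorm v) ->
    rep_kernel pi kernel_elt.
Proof.
by move=> c0 ceps fv; apply: rep_kernel_cstar_of; exact: kernel_seq_small fv.
Qed.

Lemma kernel_eltE (H : hilbert R) (pi : urep [set: G] H) :
  rep_kernel pi kernel_elt ->
  forall v, hnorm (integrated pi f v) ^+ 2 <= eps * hnorm v ^+ 2.
Proof. by move=> /cvg_of_rep_kernel; exact: kernel_seq_null. Qed.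

End KernelElement.

(** * Products of shifts in C[G] *)

Section ShiftProducts.
Variables (R : realType) (G : groupType).
Implicit Types (l : seq (G * R[i])).
Local Notation ga := (@group_algebra R G).

(** The factor 1/2 makes this a contraction when the scalar [p.2] has modulus 1. *)
Definition shift_elt (p : G * R[i]) : G -> R[i] :=
  2^-1 *: ((fun x => (x == p.1)%:R) - p.2 *: (fun x => (x == 1%g)%:R)).

Definition shift_prod l : G -> R[i] :=
  foldr (fun p => conv (shift_elt p)) (fun x => (x == 1%g)%:R) l.

Definition shift_prod_adj l : G -> R[i] :=
  foldr (fun p f => conv f (shift_elt (p.1^-1%g, Num.conj p.2)))
    (fun x => (x == 1%g)%:R) l.

Definition shift_op (H : hilbert R) (pi : urep [set: G] H) l (v : H) : H :=
  foldr (fun p w => 2^-1 *: (pi p.1 w - p.2 *: w)) v l.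

Lemma shift_eltF p : ga (shift_elt p).
Proof.
apply: group_algebraZ; apply: group_algebraB; first exact: group_algebra_delta.
by apply: group_algebraZ; exact: group_algebra_delta.
Qed.

Lemma shift_prodF l : ga (shift_prod l).
Proof.
elim: l => [|p l IHl] /=; first exact: group_algebra_delta.
by apply: group_algebra_conv => //; exact: shift_eltF.
Qed.

Lemma shift_prod_adjF l : ga (shift_prod_adj l).
Proof.
elim: l => [|p l IHl] /=; first exact: group_algebra_delta.
by apply: group_algebra_conv => //; exact: shift_eltF.
Qed.

Section InRep.
Variables (H : hilbert R) (pi : urep [set: G] H).

Lemma integrated_shift_elt p v :
  integrated pi (shift_elt p) v = 2^-1 *: (pi p.1 v - p.2 *: v).
Proof.
rewrite integratedZ; last first.
  apply: group_algebraB; first exact: group_algebra_delta.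
  by apply: group_algebraZ; exact: group_algebra_delta.
rewrite integratedB; first last.
- by apply: group_algebraZ; exact: group_algebra_delta.
- exact: group_algebra_delta.
by rewrite integratedZ ?integrated_delta ?urep1//; exact: group_algebra_delta.
Qed.

Lemma integrated_shift_prod l v :
  integrated pi (shift_prod l) v = shift_op pi l v.
Proof.
elim: l => [|p l IHl] /=; first by rewrite integrated_delta urep1.
rewrite integrated_conv ?IHl ?integrated_shift_elt//; first exact: shift_eltF.
exact: shift_prodF.
Qed.

Lemma shift_op0 l : shift_op pi l 0 = 0.
Proof. by elim: l => //= p l ->; rewrite urep0// scaler0 subr0 scaler0. Qed.

End InRep.

Lemma shift_prod_adjoint l : adjoint_pair (shift_prod l) (shift_prod_adj l).
Proof.
move=> H pi; elim: l => [|p l IHl] u v /=; first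
  by rewrite !integrated_delta !urep1.
rewrite !integrated_conv; first last.
- exact: shift_prodF.
- exact: shift_eltF.
- exact: shift_eltF.
- exact: shift_prod_adjF.
rewrite -IHl !integrated_shift_elt/= hdotZl hdotZr hdotBl hdotBr hdotZl hdotZr.
rewrite conjCK urep_dotV//; congr (_ * _).
by rewrite halfC -[RHS]/(conjc _) conjc_real.
Qed.

Lemma shift_prod_contractive l : (forall p, p \in l -> normc p.2 = 1) ->
  contractive (shift_prod l).
Proof.
move=> l1 H pi v; rewrite integrated_shift_prod; elim: l l1 =>
  [|p l IHl] l1 //=.
rewrite hnormZ normc_half ler_pdivrMl//; apply: le_trans (hnormB _ _) _.
rewrite urep_norm// hnormZ l1 ?mem_head// mul1r mulr_natl mulr2n lerD//;
  by apply: IHl => p' p'l; apply: l1; rewrite inE p'l orbT.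
Qed.

(* Lower semicontinuity of the norm, only in the case of limit 0. *)
Lemma dual_cvg_shift_op (p : nat -> irrep R [set: G])
    (pi : irrep R [set: G]) l :
  dual_cvg (fun k => iclass (p k)) (iclass pi) ->
  (forall p, p \in l -> normc p.2 = 1) ->
  (forall c : R, 0 < c -> exists M, forall k v, (M <= k)%N ->
     hnorm (shift_op (p k) l v) <= c * hnorm v) ->
  forall v, shift_op pi l v = 0.
Proof.
move=> ppi l1 lc v; apply: hnorm_eq0.
suff lee eps : 0 < eps <= 1 ->
    hnorm (shift_op pi l v) ^+ 2 <= eps * hnorm v ^+ 2.
  apply/eqP; rewrite -sqrf_eq0 eq_le sqr_ge0 andbT; apply/ler_addgt0Pl => e e0.
  rewrite addr0.
  (* The kernel element requires eps <= 1; adding 1 to |v|^2 covers v = 0. *)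
  pose d := Num.min 1 (e / (1 + hnorm v ^+ 2)).
  have v0 : 0 < 1 + hnorm v ^+ 2 by rewrite ltr_pwDl// sqr_ge0.
  have d01 : 0 < d <= 1 by rewrite lt_min ltr01 divr_gt0//= ge_min lexx.
  apply: le_trans (lee d d01) _.
  have de : d <= e / (1 + hnorm v ^+ 2) by rewrite ge_min lexx orbT.
  apply: le_trans (ler_wpM2r (sqr_ge0 _) de) _.
  by rewrite mulrAC ler_pdivrMr// ler_pM2l// lerDr.
move=> eps01; have /andP[e0 e1] := eps01.
(* As eps <= 1, the bound c = eps / 2 satisfies c^2 <= eps / 2, the condition of [kernel_eltI]. *)
have [M Mc] := lc (eps / 2) ltac:(by rewrite divr_gt0).
have lF := shift_prodF l; have l'F := shift_prod_adjF l.
have ll' := shift_prod_adjoint l.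
have ctr := shift_prod_contractive l1.
rewrite -integrated_shift_prod; apply:
  (@kernel_eltE _ _ _ _ _ lF l'F ll' ctr eps01).
apply: (dual_cvg_kernel (M := M) ppi) => k /= Mk.
rewrite dual_kernel_iclass.
apply: (@kernel_eltI _ _ _ _ _ lF l'F ll' ctr eps01 _ _ (eps / 2)) => [||w].
- lra.
- nra.
- by rewrite integrated_shift_prod; exact: Mc.
Qed.

End ShiftProducts.

(** * Induced representations and the Mackey machine *)

Section InducedTheory.
Variables (R : realType) (G : groupType) (Kf : fisubgroup G) (H : hilbert R).
Local Notation K := (fisubgroup_set Kf).
Local Notation lcoset := (@Defs.lcoset G).
Local Notation lcosets := (@Defs.lcosets G).
Variable sigma : urep K H.
Local Notation Ind := (@induced_hilbert R G Kf H sigma).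
Local Notation cosets := (fset_set (lcosets K)).
Local Notation rep := (xget 1%g).
Implicit Types (f g : Ind) (x y : G) (u v : H).

Let sK : subgroup K := fisubgroupP Kf.

Lemma mem_cosets x : lcoset K x \in cosets.
Proof.
rewrite in_fset_set ?inE; last exact: fisubgroup_fin.
exact: Defs.mem_lcosets.
Qed.

Lemma in_cosets A : A \in cosets -> lcosets K A.
Proof. by rewrite in_fset_set ?inE//; exact: fisubgroup_fin. Qed.

Lemma lcoset_eq x y : K (x^-1 * y)%g -> lcoset K x = lcoset K y.
Proof.
move=> Kxy; apply/seteqP; split=> z [k Kk <-].
  exists ((x^-1 * y)^-1 * k)%g; first by apply: subgroupM => //;
    exact: subgroupV.
  by rewrite invMg invgK !mulgA mulgV mul1g.
exists (x^-1 * y * k)%g; first exact: subgroupM.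
by rewrite !mulgA mulgV mul1g.
Qed.

Lemma cosets_repr A x : A \in cosets -> K (x^-1 * rep A)%g -> A = lcoset K x.
Proof. by move=> /in_cosets /lcoset_repr {2}<- /lcoset_eq ->. Qed.

Lemma rep_coset x : K (x^-1 * rep (lcoset K x))%g.
Proof.
have [k Kk xE] := coset_decomp Kf x.
have -> : (x^-1 * rep (lcoset K x) = k^-1)%g.
  by apply: (mulgI x); rewrite mulKVg {2}xE mulgK.
exact: subgroupV.
Qed.

Lemma induced_sumE (I : Type) (s : seq I) (P : pred I) (F : I -> Ind) x :
  (\sum_(i <- s | P i) F i : Ind) x = \sum_(i <- s | P i) F i x.
Proof. by elim/big_ind2 : _ => // f u g v <- <-. Qed.

Lemma induced_dot_single f g x :
  (forall y, ~ K (x^-1 * y)%g -> f y = 0) -> hdot Ind f g = hdot H (f x) (g x).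
Proof.
move=> fx; rewrite -[LHS]/(induced_dot f g) induced_dotE.
rewrite (bigD1_seq (lcoset K x)) ?mem_cosets ?finmap.fset_uniq//=.
rewrite (induced_dot_repr f g) [X in _ + X]big1_seq ?addr0// => A /andP[Ax Ac].
rewrite fx ?hdot0l// => Kx; move: Ax; rewrite (cosets_repr Ac Kx) eqxx//.
Qed.

Lemma ind_delta_equivariant v :
  (fun x => if `[< K x >] then sigma x^-1%g v else 0) \in equivariant sigma.
Proof.
apply/asboolP => x k Kk; case: asboolP => Kxk; case: asboolP => Kx.
- by rewrite invMg urepM//; exact: subgroupV.
- by case: Kx; rewrite -[x](mulgK k); apply: subgroupM => //; exact: subgroupV.
- by case: Kxk; exact: subgroupM.
- by rewrite urep0//; exact: subgroupV.
Qed.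

(** Embeds H isometrically as the functions supported on K; the translates of this copy to the other
    cosets span the induced space ([induced_decomp]). *)
Definition ind_delta v : Ind := Induced (ind_delta_equivariant v).

Lemma ind_deltaE v x : K x -> ind_delta v x = sigma x^-1%g v.
Proof. by move=> Kx; rewrite /=; case: asboolP. Qed.

Lemma ind_delta_out v x : ~ K x -> ind_delta v x = 0.
Proof. by move=> Kx; rewrite /=; case: asboolP. Qed.

Lemma ind_delta1 v : ind_delta v 1%g = v.
Proof. by rewrite ind_deltaE ?invg1 ?urep1//; exact: sK.1. Qed.

Lemma ind_delta_lin : linear ind_delta.
Proof.
move=> a u v; apply: val_inj; apply/funext => x.
have [Kx|Kx] := pselect (K x).
  rewrite -[RHS]/(a *: ind_delta u x + ind_delta v x) [LHS]ind_deltaE//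
    !ind_deltaE//.
  by rewrite urep_linear//; exact: subgroupV.
rewrite -[RHS]/(a *: ind_delta u x + ind_delta v x) [LHS]ind_delta_out//.
by rewrite !ind_delta_out// scaler0 addr0.
Qed.

Lemma ind_delta_dot u v : hdot Ind (ind_delta u) (ind_delta v) = hdot H u v.
Proof.
rewrite (@induced_dot_single _ _ 1%g) ?ind_delta1// => y.
by rewrite invg1 mul1g; exact: ind_delta_out.
Qed.

Lemma ind_delta_norm v : hnorm (ind_delta v) = hnorm v.
Proof. by rewrite /hnorm /dnorm ind_delta_dot. Qed.

Lemma ind_delta_eq f : (forall x, ~ K x -> f x = 0) -> f = ind_delta (f 1%g).
Proof.
move=> f0; apply: val_inj; apply/funext => x.
have [Kx|Kx] := pselect (K x); last by rewrite [LHS]f0// [RHS]ind_delta_out.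
by rewrite [RHS]ind_deltaE// -[in LHS](mul1g x) [LHS]induced_eqv.
Qed.

Lemma translate_delta k v : K k ->
  translate k (ind_delta v) = ind_delta (sigma k v).
Proof.
move=> Kk; have KVk : K k^-1%g by exact: subgroupV.
rewrite (@ind_delta_eq (translate k (ind_delta v))) => [|x Kx].
  congr ind_delta; rewrite -[LHS]/(ind_delta v (k^-1 * 1)%g) mulg1.
  by rewrite ind_deltaE// invgK.
rewrite -[LHS]/(ind_delta v (k^-1 * x)%g) ind_delta_out// => Kkx; apply: Kx.
by rewrite -[x](mulKVg k); exact: subgroupM.
Qed.

Lemma induced_decomp f :
  f = \sum_(A <- cosets) translate (rep A) (ind_delta (f (rep A))).
Proof.
apply: val_inj; apply/funext => x; rewrite [RHS]induced_sumE.
rewrite (bigD1_seq (lcoset K x)) ?mem_cosets ?finmap.fset_uniq//=.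
have Kx := rep_coset x; set y := rep _ in Kx *.
have Kyx : K (y^-1 * x)%g.
  by rewrite -[x]invgK -invMg; exact: subgroupV.
rewrite -[X in X + _]/(ind_delta (f y) (y^-1 * x)%g) ind_deltaE//.
rewrite -induced_eqv// mulKVg big1_seq ?addr0// => A /andP[Ax Ac].
apply: ind_delta_out => KA; move: Ax; rewrite [A](@cosets_repr A x) ?eqxx//.
by rewrite -[X in K X]invgK invMg invgK; exact: subgroupV.
Qed.

End InducedTheory.

Section InducedEquivalence.
Variables (R : realType) (G : groupType) (Kf : fisubgroup G)
  (H1 H2 : hilbert R).
Local Notation K := (fisubgroup_set Kf).
Variables (s1 : urep K H1) (s2 : urep K H2).

Lemma induced_rep_equiv :
  unitarily_equivalent s1 s2 ->
  unitarily_equivalent (induced_rep s1) (induced_rep s2).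
Proof.
move=> [T uT Ts]; have [T' [uT' TT' T'T]] := unitary_op_inv uT.
have KV k : K k -> K k^-1%g by apply: subgroupV; exact: fisubgroupP.
have eq12 (f : induced_hilbert s1) : (fun x => T (f x)) \in equivariant s2.
  by apply/asboolP => x k Kk; rewrite induced_eqv// Ts//; exact: KV.
have eq21 (f : induced_hilbert s2) : (fun x => T' (f x)) \in equivariant s1.
  apply/asboolP => x k Kk; rewrite induced_eqv//; apply: (can_inj TT').
  by rewrite T'T Ts ?T'T//; exact: KV.
exists (fun f => Induced (eq12 f) : induced_hilbert s2) => [|x f _]; last first.
  by apply: val_inj.
split=> [a f g|f g|f].
- by apply: val_inj; apply/funext => x; case: uT => Tl _ _; exact: Tl.
- rewrite -[LHS]/(induced_dot _ _) -[RHS]/(induced_dot f g) !induced_dotE.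
  by apply: eq_bigr => A _; case: uT => _ Td _; exact: Td.
- exists (Induced (eq21 f)); apply: val_inj; apply/funext => x; exact: T'T.
Qed.

End InducedEquivalence.

Section Characters.
Variables (R : realType) (r : nat) (G : groupType) (N : set G).
Variables (D : finGroupType) (q : G -> D) (hG : crystallographic r N q).
Variable chi : character R N.

Lemma cryst_sub : subgroup N.
Proof.
have [i [_ iD iN]] := cryst_lattice hG.
split=> [|x y /(cryst_memN hG) qx /(cryst_memN hG) qy]; apply/(cryst_memN hG).
  exact: cryst_q1 hG.
by rewrite (cryst_morph hG) (cryst_qV hG) qx qy mulgV.
Qed.

Lemma char_normc n : N n -> normc (chi n) = 1.
Proof.
by move=> Nn; apply: (@complexI R); rewrite -normCE character_norm.
Qed.

Lemma char1 : chi 1%g = 1.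
Proof.
have N1 := cryst_sub.1; have := characterM chi N1 N1; rewrite mulg1 => c1.
have c0 : chi 1%g != 0 by rewrite -normr_eq0 character_norm ?oner_eq0.
by apply: (mulfI c0); rewrite -c1 mulr1.
Qed.

(** Since N is abelian, conjugation on N depends only on the class in D. This is what reduces
    statements about all x in G to the finitely many elements of D. *)
Lemma cryst_conj_eq x y n : N n -> q x = q y -> (x^-1 * n * x = y^-1 * n * y)%g.
Proof.
move=> Nn qxy; have Nyx : N (y^-1 * x)%g.
  by apply/(cryst_memN hG); rewrite (cryst_morph hG) (cryst_qV hG) qxy mulVg.
have Nny := cryst_normal hG y Nn.
apply: (mulgI (y^-1 * x)%g).
by rewrite -[RHS](cryst_comm hG Nny Nyx) !mulgA mulgK mulgK.
Qed.

Lemma cryst_conjV x n : N n -> N (x * n * x^-1)%g.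
Proof. by move=> Nn; have := cryst_normal hG x^-1%g Nn; rewrite invgK. Qed.

Lemma char_stabPn x : ~ char_stab chi x ->
  exists2 n, N n & chi (x^-1 * n * x)%g != chi n.
Proof.
move=> /existsNP[n /not_implyP[Nn /eqP cn]].
by exists n.
Qed.

End Characters.

(** * Irreducibility of induced representations and recovery of the inducing one *)

Section Mackey.
Variables (R : realType) (r : nat) (G : groupType) (N : set G).
Variables (D : finGroupType) (q : G -> D) (hG : crystallographic r N q).
Variables (chi : character R N) (Kf : fisubgroup G).
Local Notation K := (fisubgroup_set Kf).
Hypothesis chiK : char_stab chi = K.

Let NK : N `<=` K. Proof. rewrite -chiK; exact: char_stab_lattice hG _. Qed.
Let sK : subgroup K := fisubgroupP Kf.

Section Irreducibility.
Variables (H : hilbert R) (sigma : urep K H).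
Hypothesis sigmaN : forall n v, N n -> sigma n v = chi n *: v.
Local Notation Ind := (@induced_hilbert R G Kf H sigma).

Lemma induced_lattice n (f : Ind) x : N n ->
  induced_rep sigma n f x = chi (x^-1 * n * x)%g *: f x.
Proof.
move=> Nn; have Nc := cryst_normal hG x Nn.
have NcV := subgroupV (cryst_sub hG) Nc.
rewrite -[LHS]/(f (n^-1 * x)%g).
have -> : (n^-1 * x = x * (x^-1 * n * x)^-1)%g
  by rewrite !invMg invgK !mulgA mulgV mul1g.
by rewrite induced_eqv ?invgK ?sigmaN//; exact: NK.
Qed.

Lemma induced_truncate (W : set Ind) f : lin_subspace W ->
  (forall n g, N n -> W g -> W (induced_rep sigma n g)) ->
  W f -> W (ind_delta sigma (f 1%g)).
Proof.
move=> sW WN Wf.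
have H0 (s : seq D) : exists f', [/\ W f', f' 1%g = f 1%g &
    forall x, ~ K x -> q x \in s -> f' x = 0].
  elim: s => [|d s [f' [Wf' f'1 f'0]]]; first by exists f.
  have [[x0 [Kx0 qx0]]|nx0] := pselect (exists x0, ~ K x0 /\ q x0 = d);
    last first.
    exists f'; split=> // x Kx; rewrite inE => /orP[/eqP xd|]; last exact: f'0.
    by exfalso; apply: nx0; exists x.
  have [n Nn cn] : exists2 n, N n & chi (x0^-1 * n * x0)%g != chi n.
    by apply: char_stabPn; rewrite chiK.
  set c := chi _ in cn.
  (* This operator is diagonal, so values already zero stay zero; it multiplies the value at 1 by 1
     and those over the class [d] by 0. *)
  exists ((chi n - c)^-1 *: (induced_rep sigma n f' - c *: f')).
  have fE x : ((chi n - c)^-1 *: (induced_rep sigma n f' - c *: f') : Ind) x =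
      ((chi n - c)^-1 * (chi (x^-1 * n * x)%g - c)) *: f' x.
    rewrite -[LHS]/((chi n - c)^-1 *: (induced_rep sigma n f' x - c *: f' x)).
    by rewrite induced_lattice// -scalerBl scalerA.
  split.
  - apply: lin_subspaceZ => //; apply: lin_subspaceB => //; first exact: WN.
    exact: lin_subspaceZ.
  - by rewrite fE f'1 invg1 mul1g mulg1 mulVf ?scale1r// subr_eq0 eq_sym.
  - move=> x Kx; rewrite inE fE => /orP[/eqP xd|/(f'0 _ Kx) ->]; last
    exact: scaler0.
    by rewrite (cryst_conj_eq hG Nn (etrans xd (esym qx0))) subrr mulr0 scale0r.
have [f' [Wf' <- f'0]] := H0 (enum D).
rewrite -ind_delta_eq// => x Kx; apply: f'0 => //; exact: mem_enum.
Qed.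

(** The trace [W1] of an invariant [W] on the copy of H is closed and K-invariant. If it is zero,
    translating and truncating shows that all values of functions in [W] vanish; if it is
    everything, the translates of H fill the space. *)
Lemma induced_irreducible : irreducible K sigma ->
  irreducible [set: G] (induced_rep sigma).
Proof.
move=> [[v v0] sirr]; split.
  exists (ind_delta sigma v); apply: contraNneq v0 => dv.
  by rewrite -(ind_delta1 sigma v) dv.
move=> W Wc Winv; have sW := closed_lin_subspace Wc.
have trunc f : W f -> W (ind_delta sigma (f 1%g)).
  by apply: induced_truncate => // n g _; exact: Winv.
pose W1 := [set u | W (ind_delta sigma u)].
have W1c : closed_subspace W1.
  split.
  - rewrite /W1/= (_ : ind_delta sigma 0 = 0); first by case: sW.
    by have := ind_delta_lin sigma (-1) 0 0;
      rewrite !scaleN1r oppr0 addr0 addNr.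
  - by move=> a u w Wu Ww; rewrite /W1/= ind_delta_lin; apply: sW.2.
  - move=> u l Wu /hcvgP ul; case: Wc => _ _; apply; first exact: Wu.
    apply/hcvgP => e /ul; apply: filterS => k.
    rewrite -(ind_delta_norm sigma) -[u k - l]addrC -scaleN1r ind_delta_lin.
    by rewrite scaleN1r addrC.
have W1inv k u : K k -> W1 u -> W1 (sigma k u).
  by move=> Kk W1u; rewrite /W1/= -translate_delta//; exact: (Winv k).
have [W10|W1T] := sirr W1 W1c W1inv.
- left; apply/seteqP; split=> [f Wf|_ ->]; last by case: sW.
  apply: val_inj; apply/funext => x.
  have : W1 (f x).
    rewrite /W1/= -[x]invgK -[x^-1^-1%g]mulg1.
    by apply: (trunc (induced_rep sigma x^-1%g f)); exact: Winv.
  by rewrite W10.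
- right; apply/seteqP; split=> // f _; rewrite [f]induced_decomp.
  apply: lin_subspace_sum => // A _; apply: (Winv (xget 1%g A)) => //.
  by have : W1 (f (xget 1%g A)) by rewrite W1T.
Qed.

End Irreducibility.

Variables (gam : D -> G) (gamK : forall d, q (gam d) = d).
Variables (H : hilbert R) (pi : urep [set: G] H).

Definition weight_space : set H :=
  [set v | forall n, N n -> pi n v = chi n *: v].
Local Notation E := weight_space.

Lemma weight_space_closed : closed_subspace E.
Proof.
split.
- by move=> n _; rewrite urep0// scaler0.
- move=> a u v Eu Ev n Nn; rewrite urep_linear// Eu// Ev//.
  by rewrite scalerDr !scalerA mulrC.
- move=> u l Eu /hcvgP ul n Nn; apply/eqP; rewrite -subr_eq0;
  apply/eqP/hnorm_eq0.
  apply/eqP; rewrite eq_le hnorm_ge0 andbT; apply/ler_addgt0Pl => e e0;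
    rewrite addr0.
  have [k _ /(_ k (leqnn k))/= uk] := ul (e / 2) ltac:(by rewrite divr_gt0).
  have -> : pi n l - chi n *: l = pi n (l - u k) - chi n *: (l - u k).
    by rewrite urepB// Eu// scalerBr opprB addrA subrK.
  apply: le_trans (hnormB _ _) _; rewrite urep_norm// hnormZ char_normc// mul1r.
  by rewrite hnormBC; lra.
Qed.

Lemma weight_space_stable x v : K x -> E v -> E (pi x v).
Proof.
rewrite -chiK => Sx Ev n Nn; have Nc := cryst_normal hG x Nn.
rewrite -urepM//; have -> : (n * x = x * (x^-1 * n * x))%g
  by rewrite !mulgA mulgV mul1g.
by rewrite urepM// Ev// urepZ// -(Sx n Nn).
Qed.

(** Some n in N separates chi from its translate by x, and eigenvectors of the unitary [pi n] with
    distinct eigenvalues are orthogonal. *)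
Lemma weight_space_orth x u v : ~ K x -> E u -> E v -> hdot H (pi x u) v = 0.
Proof.
rewrite -chiK => /char_stabPn[n Nn cn] Eu Ev.
have Nc := cryst_normal hG x Nn.
have pnx : pi n (pi x u) = chi (x^-1 * n * x)%g *: pi x u.
  rewrite -urepM//; have -> : (n * x = x * (x^-1 * n * x))%g.
    by rewrite !mulgA mulgV mul1g.
  by rewrite urepM// Eu// urepZ.
have := urep_dot pi (pi x u) v (I : [set: G] n);
  rewrite pnx Ev// hdotZl hdotZr mulrA.
set c := chi _ in cn *; set d := chi n in cn *; set z := hdot _ _ _ => cdz.
apply/eqP; apply: contraNT cn => z0.
have cd : c * Num.conj d = 1 by apply: (mulIf z0); rewrite mul1r.
have dd : d * Num.conj d = 1 by rewrite -normCK character_norm ?expr1n.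
have d0 : Num.conj d != 0.
  by apply/eqP => d0; move/eqP: dd; rewrite d0 mulr0 eq_sym oner_eq0.
by apply/eqP/(mulIf d0); rewrite cd dd.
Qed.

Lemma weight_orbit x v : E v ->
  pi x v = chi ((gam (q x))^-1 * x)%g *: pi (gam (q x)) v.
Proof.
move=> Ev; have Nx : N ((gam (q x))^-1 * x)%g.
  by apply/(cryst_memN hG); rewrite (cryst_morph hG) (cryst_qV hG) gamK mulVg.
by rewrite -urepZ// -Ev// -urepM// mulKVg.
Qed.

(** For [v] of weight chi this is the span of the whole G-orbit, since N only rescales [v]. It is
    therefore invariant, and closed because finite-dimensional. *)
Definition orbit_span (v : H) : set H := lspan (fun d : D => pi (gam d) v).

Lemma orbit_span_inv v x w : E v -> orbit_span v w -> orbit_span v (pi x w).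
Proof.
move=> Ev [c _ <-]; rewrite urep_sum//.
apply: (lin_subspace_sum _ (lspan_lin _)) => d _; rewrite urepZ//.
apply: lin_subspaceZ; first exact: lspan_lin.
rewrite -urepM// weight_orbit//; apply: lin_subspaceZ; first exact: lspan_lin.
exact: (lspan_gen (fun d : D => pi (gam d) v)).
Qed.

Lemma orbit_span_mem v : E v -> orbit_span v v.
Proof.
move=> Ev; rewrite -[X in orbit_span _ X](urep1 pi (subgroupT G)).
rewrite weight_orbit//.
apply: lin_subspaceZ; first exact: lspan_lin.
exact: (lspan_gen (fun d : D => pi (gam d) v)).
Qed.

Hypothesis pi_irr : irreducible [set: G] pi.

Lemma orbit_spanT v : E v -> v != 0 -> orbit_span v = setT.
Proof.
move=> Ev v0.
have [|s0|//] := pi_irr.2 _ (lspan_closed (fun d => pi (gam d) v)).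
  by move=> x w _; exact: orbit_span_inv.
by have := orbit_span_mem Ev; rewrite /orbit_span s0 => v00;
  rewrite v00 eqxx in v0.
Qed.

(** Expand e over the orbit of v. The terms with [gam d] outside K are orthogonal to the weight
    space, so the sum e' of the others differs from e by a vector of the weight space that is
    orthogonal to itself. *)
Lemma weight_spaceE v e : E v -> v != 0 -> E e ->
  exists c : D -> R[i],
    e = \sum_d c d *: (if `[< K (gam d) >] then pi (gam d) v else 0).
Proof.
move=> Ev v0 Ee; have : orbit_span v e by rewrite orbit_spanT.
move=> [c _ ce]; exists c; apply/eqP; rewrite -subr_eq0; set e' := \sum_d _.
have sE : lin_subspace E by exact: closed_lin_subspace weight_space_closed.
apply/eqP/hdot_eq0; have Ee' : E e'.
  apply: lin_subspace_sum => // d _; apply: (lin_subspaceZ _ sE).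
  by case: asboolP => Kd; [exact: weight_space_stable|case: sE].
have Ed : E (e - e') by exact: lin_subspaceB sE Ee Ee'.
rewrite -{1}ce /e' -sumrB hdot_suml big1// => d _; rewrite -scalerBr hdotZl.
case: asboolP => Kd; first by rewrite subrr hdot0l mulr0.
by rewrite subr0 weight_space_orth// mulr0.
Qed.

Local Notation Eh := (subspace_hilbert weight_space_closed).

Definition weight_rep : urep K Eh :=
  @subrep _ _ _ weight_space_closed _ _ _ pi sK (fun x _ => I)
    weight_space_stable (subgroupT G).

Lemma weight_repE x (v : Eh) : K x -> val (weight_rep x v) = pi x (val v).
Proof. by move=> Kx; exact: (val_subrep weight_space_stable v Kx). Qed.

Lemma weight_repN n (v : Eh) : N n -> weight_rep n v = chi n *: v.
Proof.
move=> Nn; apply: val_inj; rewrite weight_repE; last exact: NK.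
exact: (subspace_in v) Nn.
Qed.

Hypothesis weight_neq0 : exists2 v, E v & v != 0.

Lemma subspace_val_sum (I : Type) (s : seq I) (P : pred I) (F : I -> Eh) :
  val (\sum_(i <- s | P i) F i) = \sum_(i <- s | P i) val (F i).
Proof. by elim/big_ind2 : _ => // f u g v <- <-. Qed.

Lemma weight_rep_gen (v : Eh) : v != 0 ->
  lspan (fun d => if `[< K (gam d) >] then weight_rep (gam d) v else 0) = setT.
Proof.
move=> v0; apply/seteqP; split=> // e _.
have v0' : val v != 0 by apply: contraNneq v0 => v0; apply/eqP/val_inj.
have [c ce] := weight_spaceE (subspace_in v) v0' (subspace_in e).
exists c => //; apply: val_inj; rewrite subspace_val_sum [RHS]ce;
  apply: eq_bigr => d _.
rewrite -[LHS]/(c d *: val _); congr (_ *: _).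
by case: asboolP => // Kd; exact: weight_repE.
Qed.

Lemma weight_vec : exists v : Eh, v != 0.
Proof.
have [v Ev v0] := weight_neq0.
exists (Subspace (subspace_memP weight_space_closed Ev)).
by apply: contraNneq v0 => /(congr1 val) /= ->.
Qed.

Lemma weight_rep_irr : irreducible K weight_rep.
Proof.
split; first exact: weight_vec.
move=> W Wc Winv; have sW := closed_lin_subspace Wc.
have [[v [Wv v0]]|W0] := pselect (exists v, W v /\ v != 0).
  right; rewrite -(weight_rep_gen v0); apply/seteqP; split=> [w _|].
    by rewrite weight_rep_gen.
  apply: lspan_sub => // d; case: asboolP => Kd; first exact: Winv.
  by case: sW.
left; apply/seteqP; split=> [w Ww|_ ->]; last by case: sW.
by apply/eqP; apply: contrapT => /negP w0; apply: W0; exists w.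
Qed.

Lemma weight_rep_dim : exists2 m, (0 < m)%N & has_dim Eh m.
Proof.
have [v v0] := weight_vec; have [m mP] := lspan_has_dim (weight_rep_gen v0).
exists m => //; case: m => // in mP *; case: mP => e [g eg ge].
by move: v0; rewrite -(ge v) big_ord0 eqxx.
Qed.

Local Notation Ind := (@induced_hilbert R G Kf Eh weight_rep).
Local Notation cosets := (fset_set (Defs.lcosets K)).
Local Notation rep := (xget 1%g).

(** The intertwiner from the induced space to H that sends the x-translate of the function at the
    trivial coset with value v to pi x v ([weight_map_delta]). *)
Definition weight_map (f : Ind) : H :=
  \sum_(A <- cosets) pi (rep A) (val (f (rep A))).

Lemma weight_map_lin : linear weight_map.
Proof.
move=> a f g; rewrite /weight_map scaler_sumr -big_split/=; apply: eq_bigr =>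
  A _.
by rewrite -urep_linear.
Qed.

(** For distinct cosets A and B, (rep B)^-1 (rep A) lies outside K, so the mixed terms vanish by
    [weight_space_orth]. *)
Lemma weight_map_dot f g : hdot H (weight_map f) (weight_map g) = hdot Ind f g.
Proof.
rewrite -[RHS]/(induced_dot f g) induced_dotE /weight_map hdot_suml.
rewrite big_seq [RHS]big_seq; apply: eq_bigr => A Ac; rewrite hdot_sumr.
rewrite (bigD1_seq A) ?finmap.fset_uniq//= urep_dot//.
rewrite [X in _ + X]big1_seq ?addr0// => B /andP[BA Bc].
rewrite -[X in hdot H X _](urepVK pi (subgroupT G) (x := rep B))// urep_dot//.
rewrite -urepM// weight_space_orth//; [|exact: subspace_in|exact: subspace_in].
move=> /(cosets_repr Ac) AE; move: BA; rewrite AE lcoset_repr ?eqxx//.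
exact: in_cosets Bc.
Qed.

Lemma weight_map_delta x (v : Eh) :
  weight_map (translate x (ind_delta weight_rep v)) = pi x (val v).
Proof.
rewrite /weight_map (bigD1_seq (Defs.lcoset K x)) ?mem_cosets
  ?finmap.fset_uniq//=.
have Kx := rep_coset Kf x; case: asboolP => // _.
rewrite weight_repE; last exact: subgroupV.
rewrite -urepM// invMg invgK mulKVg big1_seq ?addr0// => A /andP[Ax Ac].
case: asboolP => Kx'; last by rewrite urep0.
by move: Ax; rewrite (cosets_repr Ac Kx') eqxx.
Qed.

Lemma weight_map_unitary : unitary_op weight_map.
Proof.
split; [exact: weight_map_lin|exact: weight_map_dot|move=> w].
have [v Ev v0] := weight_neq0.
have : orbit_span v w by rewrite orbit_spanT.
move=> [c _ <-].
pose v' : Eh := Subspace (subspace_memP weight_space_closed Ev).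
exists (\sum_d c d *: translate (gam d) (ind_delta weight_rep v')).
have lZ a f : weight_map (a *: f) = a *: weight_map f.
  by rewrite /weight_map scaler_sumr; apply: eq_bigr => A _; rewrite -urepZ.
have lD f g : weight_map (f + g) = weight_map f + weight_map g.
  by have := weight_map_lin 1 f g; rewrite !scale1r.
rewrite (big_morph weight_map (id1 := 0) (op1 := +%R)) => [||]; first last.
- by rewrite /weight_map big1// => A _; rewrite urep0.
- exact: lD.
by apply: eq_bigr => d _; rewrite lZ weight_map_delta.
Qed.

Lemma weight_map_intertwines x f :
  weight_map (induced_rep weight_rep x f) = pi x (weight_map f).
Proof.
have lD g h : weight_map (g + h) = weight_map g + weight_map h.
  by have := weight_map_lin 1 g h; rewrite !scale1r.
have l0 : weight_map 0 = 0 by rewrite /weight_map big1// => A _; rewrite urep0.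
have lsum := big_morph weight_map lD l0.
rewrite [in LHS](induced_decomp f) (@urep_sum _ _ _ _
  (induced_rep weight_rep))// lsum.
rewrite [in RHS]/weight_map urep_sum//; apply: eq_bigr => A _.
rewrite -[induced_rep _ _ _]/(translate _ _) -translateM// weight_map_delta.
by rewrite urepM.
Qed.

Lemma mackey_equiv : unitarily_equivalent pi (induced_rep weight_rep).
Proof.
apply: unitarily_equivalent_sym; exists weight_map; first
  exact: weight_map_unitary.
by move=> x f _; exact: weight_map_intertwines.
Qed.

End Mackey.

(** * Limits of induced representations *)

Section StrongLimits.
Variables (R : realType) (H : hilbert R).
Implicit Types (u v : nat -> H).

Lemma hcvg_cst (l : H) : hcvg (fun=> l) l.
Proof. by apply/hcvgP => e e0; apply: nearW => k; rewrite subrr hnorm0. Qed.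

Lemma hcvgD u v l l' : hcvg u l -> hcvg v l' ->
  hcvg (fun k => u k + v k) (l + l').
Proof.
move=> /hcvgP ul /hcvgP vl; apply/hcvgP => e e0.
have d0 : 0 < e / 2 by rewrite divr_gt0.
move: (ul _ d0) (vl _ d0); apply: filterS2 => k uk vk.
rewrite opprD addrACA; apply: le_lt_trans (hnormD _ _) _; lra.
Qed.

Lemma hcvgZ (a : R[i]) u l : hcvg u l -> hcvg (fun k => a *: u k) (a *: l).
Proof.
move=> /hcvgP ul; apply/hcvgP => e e0.
have a1 : 0 < 1 + normc a by rewrite ltr_pwDl// normc_ge0.
have d0 : 0 < e / (1 + normc a) by rewrite divr_gt0.
move: (ul _ d0); apply: filterS => k; rewrite ltr_pdivlMr// => uk.
rewrite -scalerBr hnormZ; apply: le_lt_trans uk.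
by rewrite mulrC ler_wpM2l ?hnorm_ge0// lerDr.
Qed.

Lemma hcvg_sum (I : Type) (s : seq I) (F : I -> nat -> H) (L : I -> H) :
  (forall i, hcvg (F i) (L i)) ->
  hcvg (fun k => \sum_(i <- s) F i k) (\sum_(i <- s) L i).
Proof.
move=> FL; elim: s => [|i s IHs].
  by rewrite big_nil (_ : (fun _ => _) = fun=> 0);
    [exact: hcvg_cst|apply/funext => k; rewrite big_nil].
rewrite big_cons (_ : (fun _ => _) = fun k => F i k + \sum_(j <- s) F j k).
  exact: hcvgD.
by apply/funext => k; rewrite big_cons.
Qed.

Lemma hcvg_le u l (A : set nat) (c : R) : hcvg u l ->
  (forall M, exists2 k, (M <= k)%N & A k) ->
  (forall k, A k -> hnorm (u k) <= c) ->
  hnorm l <= c.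
Proof.
move=> /hcvgP ul Ainf uc; apply/ler_addgt0Pl => e e0.
have [M _ Mu] := ul e e0; have [k Mk Ak] := Ainf M.
have := Mu k Mk; rewrite hnormBC => uk.
by apply: le_trans (hnorm_sub_le l (u k)) _; rewrite addrC lerD ?uc// ltW.
Qed.

Lemma cvg_normc (a : nat -> R[i]) (l : R[i]) (e : R) :
  a k @[k --> \oo] --> (l : R[i]^o) -> 0 < e ->
    \forall k \near \oo, normc (a k - l) < e.
Proof.
move=> al e0; have e0' : 0 < e%:C%C by rewrite ltcR.
have [M _ Mk] := (@cvgrPdist_lt _ R[i]^o nat \oo _ a l).1 al _ e0'.
by exists M => // k /Mk alk; rewrite -ltcR -normCE distrC.
Qed.

Lemma hcvg_scale (a : nat -> R[i]) (l : R[i]) (w : H) :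
  a k @[k --> \oo] --> (l : R[i]^o) -> hcvg (fun k => a k *: w) (l *: w).
Proof.
move=> al; apply/hcvgP => e e0.
have d0 : 0 < e / (1 + hnorm w) by rewrite divr_gt0// ltr_pwDl// hnorm_ge0.
move: (cvg_normc al d0); apply: filterS => k.
rewrite ltr_pdivlMr ?ltr_pwDl ?hnorm_ge0// -scalerBl hnormZ; apply: le_lt_trans.
by rewrite ler_wpM2l ?normc_ge0// lerDr.
Qed.

End StrongLimits.

Section InducedLimits.
Variables (R : realType) (G : groupType) (Kf : fisubgroup G) (H : hilbert R).
Local Notation K := (fisubgroup_set Kf).
Local Notation cosets := (fset_set (Defs.lcosets K)).
Local Notation rep := (xget 1%g).

Lemma induced_norm_sum (s : urep K H) (f : induced_hilbert s) :
  hnorm f <= \sum_(A <- cosets) hnorm (f (rep A)).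
Proof.
rewrite [f in hnorm f]induced_decomp; apply: le_trans (hnorm_sum _ _) _.
apply: ler_sum => A _; rewrite -(ind_delta_norm s).
by rewrite (urep_norm (induced_rep s) _ (x := rep A)).
Qed.

Lemma induced_norm_ge (s : urep K H) (f : induced_hilbert s) x :
  hnorm (f x) <= hnorm f.
Proof. exact: induced_dnorm_ge. Qed.

Lemma integrated_induced (s : urep K H) (S : {fset G}) (u : G -> R[i])
    (f : induced_hilbert s) x : fsupport S u ->
  integrated (induced_rep s) u f x = \sum_(g <- S) u g *: f (g^-1 * x)%g.
Proof. by move=> Su; rewrite (integratedE _ _ Su) induced_sumE. Qed.

Variables (sigma : nat -> urep K H) (sigmal : urep K H).
Hypothesis sigma_cvg : forall x v, K x ->
  hcvg (fun k => sigma k x v) (sigmal x v).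

(* The function in the space of ind sigma_k with the same values as f on the
   chosen coset representatives. *)
Definition transfer k (f : induced_hilbert sigmal) :
    induced_hilbert (sigma k) :=
  \sum_(A <- cosets) translate (rep A) (ind_delta (sigma k) (f (rep A))).

Lemma transfer_cvg f x : hcvg (fun k => transfer k f x) (f x).
Proof.
rewrite [f in X in hcvg _ X]induced_decomp induced_sumE.
rewrite (_ : (fun k => _) = fun k => \sum_(A <- cosets)
    (translate (rep A) (ind_delta (sigma k) (f (rep A)))) x); last first.
  by apply/funext => k; rewrite /transfer induced_sumE.
apply: hcvg_sum => A /=; case: asboolP => KA; last exact: hcvg_cst.
by apply: sigma_cvg; apply: subgroupV => //; exact: fisubgroupP.
Qed.

Lemma transfer_norm k f :
  hnorm (transfer k f) <= \sum_(A <- cosets) hnorm (f (rep A)).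
Proof.
apply: le_trans (hnorm_sum _ _) _; apply: ler_sum => A _.
by rewrite (urep_norm (induced_rep (sigma k)) _ (x := rep A))// ind_delta_norm.
Qed.

(** The index j is fixed first. As [u j] has finite support, its action evaluated at a point is a
    finite sum and passes to the limit in k, along which [rep_kernel_bound] holds with the same d
    for all k in [P]. *)
Lemma rep_kernel_limit (P : set nat) :
  (forall M, exists2 k, (M <= k)%N & P k) ->
  \bigcap_(k in P) rep_kernel (induced_rep (sigma k)) `<=`
  rep_kernel (induced_rep sigmal).
Proof.
move=> Pinf a aP u au f; have [ugr _] := cstar_class_cauchy au.
apply/hcvgP => e e0.
pose B := \sum_(A <- cosets) hnorm (f (rep A)).
have B0 : 0 <= B by apply: sumr_ge0 => A _; exact: hnorm_ge0.
(* Each of the m cosets will contribute at most d * B, so d is taken with m * (d * B) < e. *)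
pose m : R := (size cosets)%:R.
have C0 : 0 < 1 + m * B by rewrite ltr_pwDl// mulr_ge0.
have d0 : 0 < e / (1 + m * B) by rewrite divr_gt0.
set d := e / _ in d0; have [M uM] := rep_kernel_bound au d0.
exists M => // j /= Mj; rewrite subr0.
have /group_algebraP[S Su] := ugr j.
have pt x : hnorm (integrated (induced_rep sigmal) (u j) f x) <= d * B.
  apply: (hcvg_le (u := fun k => integrated (induced_rep (sigma k)) (u j)
    (transfer k f) x) _ Pinf).
    rewrite (integrated_induced _ _ Su) (_ : (fun k => _) =
      fun k => \sum_(g <- S) u j g *: transfer k f (g^-1 * x)%g).
      by apply: hcvg_sum => g; apply: hcvgZ; exact: transfer_cvg.
    by apply/funext => k; rewrite (integrated_induced _ _ Su).
  move=> k Pk; apply: le_trans (induced_norm_ge _ _) _.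
  apply: le_trans (uM j Mj _ (induced_rep (sigma k)) _ (aP k Pk)) _.
  by rewrite ler_wpM2l ?(ltW d0)//; exact: transfer_norm.
apply: le_lt_trans (induced_norm_sum _) _.
apply: (@le_lt_trans _ _ (\sum_(A <- cosets) d * B)).
  by apply: ler_sum => A _; exact: pt.
rewrite big_const_seq count_predT iter_addr_0 -mulr_natl -/m.
by rewrite mulrCA /d mulrAC ltr_pdivrMr// ltr_pM2l// ltrDr.
Qed.

End InducedLimits.

(** * Weights from vanishing products of shifts *)

Section CommonWeights.
Variables (R : realType) (G : groupType) (N : set G) (D : finType).
Variables (H : hilbert R) (pi : urep [set: G] H) (c : D -> G -> R[i]).

(** A family (n_d) is encoded as a list of pairs, so that an induction can run over the suffixes of
    an enumeration of D. *)
Definition weight_shifts (l : seq (D * G)) : seq (G * R[i]) :=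
  [seq (p.2, c p.1 p.2) | p <- l].

(* Take a longest product of shifts, over a suffix of the enumeration of D, that
   does not vanish identically: its values are eigenvectors. *)
Lemma common_weight :
  (exists v : H, v != 0) ->
  (forall l, map fst l = enum D -> (forall p, p \in l -> N p.2) ->
     forall v, shift_op pi (weight_shifts l) v = 0) ->
  exists d, exists2 w, w != 0 & forall n, N n -> pi n w = c d n *: w.
Proof.
move=> [v0 v0_neq0]; elim: (enum D) => [|d s IHs] sl.
  (* The empty product is the identity, which does not kill [v0]. *)
  by have := sl [::] erefl ltac:(by []) v0 => /= v00;
    rewrite v00 eqxx in v0_neq0.
have [|nz] := pselect (forall l, map fst l = s ->
    (forall p, p \in l -> N p.2) ->
    forall v, shift_op pi (weight_shifts l) v = 0).
  exact: IHs.
have [l ls [lN [v wv]]] : exists2 l, map fst l = s &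
    (forall p, p \in l -> N p.2) /\
    exists v, shift_op pi (weight_shifts l) v != 0.
  apply: contrapT => no; apply: nz => l ls lN v; apply/eqP;
    apply: contrapT => /negP wv.
  by apply: no; exists l => //; split=> //; exists v.
exists d, (shift_op pi (weight_shifts l) v) => // n Nn.
have := sl ((d, n) :: l) _ _ v; rewrite /= ls => /(_ erefl) E.
have {E} : 2^-1 *: (pi n (shift_op pi (weight_shifts l) v) -
    c d n *: shift_op pi (weight_shifts l) v) = 0.
  by apply: E => p; rewrite inE => /orP[/eqP -> //|]; exact: lN.
move/eqP; rewrite scaler_eq0 invr_eq0 pnatr_eq0/= subr_eq0 => /eqP //.
Qed.

End CommonWeights.

Section ScalarShifts.
Variables (R : realType) (G : groupType) (H : hilbert R) (pi : urep [set: G] H).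

Lemma shift_op_eigen (b : G -> R[i]) (l : seq (G * R[i])) w :
  (forall p, p \in l -> pi p.1 w = b p.1 *: w) ->
  shift_op pi l w = (\prod_(p <- l) (2^-1 * (b p.1 - p.2))) *: w.
Proof.
elim: l => [|p l IHl] lw /=; first by rewrite big_nil scale1r.
rewrite IHl => [|p' p'l]; last by apply: lw; rewrite inE p'l orbT.
rewrite urepZ// lw ?mem_head// big_cons !scalerA -scalerBl scalerA.
by congr (_ *: _); ring.
Qed.

Lemma shift_op_kernel (l : seq (G * R[i])) :
  lin_subspace [set w | shift_op pi l w = 0].
Proof.
split=> [|a u v /= u0 v0]; first exact: shift_op0.
rewrite -integrated_shift_prod integrated_linear; last exact: shift_prodF.
by rewrite !integrated_shift_prod u0 v0 scaler0 addr0.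
Qed.

End ScalarShifts.

Section CrystalWeights.
Variables (R : realType) (r : nat) (G : groupType) (N : set G).
Variables (D : finGroupType) (q : G -> D) (hG : crystallographic r N q).
Variables (gam : D -> G) (gamK : forall d, q (gam d) = d).
Variable chi : character R N.

Definition orbit_char (d : D) (n : G) : R[i] := chi ((gam d)^-1 * n * gam d)%g.

Lemma orbit_char_norm d n : N n -> normc (orbit_char d n) = 1.
Proof. by move=> Nn; apply: char_normc; exact: cryst_normal hG _ _ Nn. Qed.

(** [common_weight] provides a vector whose weight is the translate of chi by some [gam d]; the
    inverse of [gam d] carries it to weight chi. *)
Lemma weight_from_shifts (H : hilbert R) (pi : urep [set: G] H) :
  (exists v : H, v != 0) ->
  (forall l, map fst l = enum D -> (forall p, p \in l -> N p.2) ->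
     forall v, shift_op pi (weight_shifts orbit_char l) v = 0) ->
  exists2 v, weight_space chi pi v & v != 0.
Proof.
move=> Hn0 /(common_weight Hn0)[d [w w0 wE]].
exists (pi (gam d)^-1%g w) => [n Nn|]; last first.
  by apply: contraNneq w0 => gw; rewrite -(urepVK pi (subgroupT G)
    (x := gam d) w)// gw urep0.
have Nc := cryst_conjV hG (gam d) Nn.
rewrite -urepM//.
have -> : (n * (gam d)^-1 = (gam d)^-1 * (gam d * n * (gam d)^-1))%g.
  by rewrite !mulgA mulVg mul1g.
rewrite urepM// wE// urepZ// /orbit_char; congr (chi _ *: _).
by rewrite !mulgA mulVg mul1g mulgKV.
Qed.

Lemma orbit_vec (H : hilbert R) (pi : urep [set: G] H) v d n :
  weight_space chi pi v -> N n ->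
  pi n (pi (gam d) v) = orbit_char d n *: pi (gam d) v.
Proof.
move=> Ev Nn; have Nc := cryst_normal hG (gam d) Nn.
rewrite -urepM//; have -> : (n * gam d = gam d * ((gam d)^-1 * n * gam d))%g.
  by rewrite !mulgA mulgV mul1g.
by rewrite urepM// Ev// urepZ.
Qed.

(** The shift product is diagonal on the spanning vectors [pi (gam d) v], and its factor indexed by
    [d] vanishes on the one for [d]. *)
Lemma orbit_span_shifts (H : hilbert R) (pi : urep [set: G] H) v l w :
  weight_space chi pi v -> map fst l = enum D -> (forall p, p \in l -> N p.2) ->
  orbit_span gam pi v w -> shift_op pi (weight_shifts orbit_char l) w = 0.
Proof.
move=> Ev lD lN; move: w; apply: lspan_sub; first exact: shift_op_kernel.
move=> d /=; rewrite (@shift_op_eigen _ _ _ _ (orbit_char d)); last first.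
  by move=> _ /mapP[p pl ->] /=; apply: orbit_vec => //; exact: lN.
have : d \in map fst l by rewrite lD mem_enum.
move=> /mapP[p pl dp]; rewrite big_map (big_rem p pl)/= -dp.
by rewrite subrr mulr0 mul0r scale0r.
Qed.

(** A minimal nonzero invariant subspace of the finite-dimensional orbit span is irreducible. It may
    miss v, but the shift products vanish on it as on the whole span, and this provides a new vector
    of weight chi. *)
Lemma sub_irrep (H : hilbert R) (pi : urep [set: G] H) v :
  weight_space chi pi v -> v != 0 ->
  exists pi0 : irrep R [set: G], rep_kernel pi `<=` rep_kernel pi0 /\
    exists2 w, weight_space chi pi0 w & w != 0.
Proof.
move=> Ev v0.
pose F : set (set H) := [set W | [/\ closed_subspace W,
  forall x w, W w -> W (pi x w), W `<=` orbit_span gam pi v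
  & exists2 w, W w & w != 0]].
have Fspan : F (orbit_span gam pi v).
  split=> //; first exact: lspan_closed.
    by move=> x w; exact: (orbit_span_inv hG gamK _ Ev).
  by exists v => //; exact: (orbit_span_mem hG gamK Ev).
have [||W [Wc Winv Wspan [w0 Ww0 w00]] Wmin] :=
    @lspan_minimal _ _ _ (fun d : D => pi (gam d) v) F.
- by exists (orbit_span gam pi v).
- by move=> V [Vc _ Vs _]; split=> //; exact: closed_lin_subspace.
pose pi1 := @subrep _ _ _ Wc _ _ _ pi (subgroupT G) (fun x _ => I)
  (fun x w _ => Winv x w) (subgroupT G).
have pi1E x (w : subspace_hilbert Wc) : val (pi1 x w) = pi x (val w).
  by apply: (@val_subrep _ _ _ Wc _ [set: G] [set: G] pi
    (fun x w _ => Winv x w)).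
have W_n0 : exists v : subspace_hilbert Wc, v != 0.
  exists (Subspace (subspace_memP Wc Ww0)).
  by apply: contraNneq w00 => /(congr1 val) /= ->.
have pi1_irr : irreducible [set: G] pi1.
  split=> // V Vc Vinv; have sV := closed_lin_subspace Vc.
  have [[u [Vu u0]]|V0] := pselect (exists u, V u /\ u != 0); last first.
    left; apply/seteqP; split=> [w Vw|_ ->]; last by case: sV.
    by apply/eqP; apply: contrapT => /negP w1; apply: V0; exists w.
  right; apply/seteqP; split=> // w _.
  have VW : [set val w | w in V] `<=` W by move=> _ [w' _ <-];
    exact: subspace_in.
  have : [set val w | w in V] (val w).
    rewrite (Wmin [set val w | w in V])//; first exact: subspace_in.
    split.
    - exact: subspace_closed.
    - move=> x _ [w' Vw' <-]; exists (pi1 x w'); [exact: Vinv|exact: pi1E].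
    - exact: subset_trans VW Wspan.
    - exists (val u); first by exists u.
      by apply: contraNneq u0 => u0; apply/eqP/val_inj.
  by move=> [w' Vw' /val_inj <-].
exists (Irrep pi1_irr); split.
  apply: (@rep_kernelS _ _ _ _ pi1 pi val) => //.
apply: (weight_from_shifts (pi := pi1)) => // l lD lN w; apply: val_inj.
have -> : val (shift_op pi1 (weight_shifts orbit_char l) w) =
    shift_op pi (weight_shifts orbit_char l) (val w).
  elim: (weight_shifts _ _) => // p s IHs.
  by rewrite /= -IHs -pi1E.
by apply: (orbit_span_shifts Ev) => //; apply: Wspan; exact: subspace_in.
Qed.

End CrystalWeights.

(** * Generic sequences: restriction to N, irreducibility, and decay of shift products *)

Section GenericSequence.
Variables (R : realType) (r : nat) (G : groupType) (N : set G).
Variables (D : finGroupType) (q : G -> D) (hG : crystallographic r N q).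
Variables (gam : D -> G) (gamK : forall d, q (gam d) = d).
Hypothesis gam1 : gam 1%g = 1%g.

Lemma shift_op_induced (chi : character R N) (Kf : fisubgroup G) (H : hilbert R)
    (s : urep Kf H) (l : seq (G * R[i])) (f : induced_hilbert s) x :
  char_stab chi = Kf -> (forall n v, N n -> s n v = chi n *: v) ->
  (forall p, p \in l -> N p.1) ->
  shift_op (induced_rep s) l f x =
  (\prod_(p <- l) (2^-1 * (chi (x^-1 * p.1 * x)%g - p.2))) *: f x.
Proof.
move=> chiK sN; elim: l => [|p l IHl] lN /=; first by rewrite big_nil scale1r.
set g := shift_op _ _ _ in IHl *.
rewrite -[LHS]/(2^-1 *: (induced_rep s p.1 g x - p.2 *: g x)).
have Np : N p.1 by apply: lN; rewrite mem_head.
rewrite (induced_lattice hG chiK sN _ _ Np) -scalerBl.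
have -> : g x = \prod_(p <- l) (2^-1 * (chi (x^-1 * p.1 * x)%g - p.2)) *: f x.
  by apply: IHl => p' p'l; apply: lN; rewrite inE p'l orbT.
by rewrite big_cons !scalerA.
Qed.

Lemma induced_norm_scale (Kf : fisubgroup G) (H : hilbert R) (s : urep Kf H)
    (f g : induced_hilbert s) (c : R) : 0 <= c ->
  (forall x, hnorm (f x) <= c * hnorm (g x)) -> hnorm f <= c * hnorm g.
Proof.
move=> c0 fg; rewrite -(@ler_pXn2r _ 2)// ?nnegrE ?mulr_ge0 ?hnorm_ge0//.
rewrite exprMn [hnorm f ^+ 2]induced_dnorm_sqr [hnorm g ^+ 2]induced_dnorm_sqr.
rewrite mulr_sumr; apply: ler_sum => A _; rewrite -exprMn.
by rewrite ler_pXn2r ?nnegrE ?mulr_ge0 ?hnorm_ge0.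
Qed.

Variables (chi : nat -> character R N) (chil : character R N).
Variables (Gs : fisubgroup G) (n : nat) (H : hilbert R).
Variables (sigma : nat -> urep Gs H) (sigmal : urep Gs H).
Variables (lam : nat -> D -> R[i]) (laml : D -> R[i]) (Phi : D -> H -> H).
Hypothesis gen : generic_data q gam chi chil n sigma sigmal lam laml Phi.

Let q1 m : N m -> q m = 1%g. Proof. by move/(cryst_memN hG). Qed.

Let GsN m : N m -> fisubgroup_set Gs m.
Proof. by rewrite -(gen_stab gen 0); exact: char_stab_lattice hG _ _. Qed.

(** As [gam 1 = 1], the cocycle is 1 at (1, 1), so [Phi 1] is an idempotent unitary. *)
Lemma generic_Phi1 v : Phi 1%g v = v.
Proof.
have [Pu PM] := gen_Phi gen; have Q1 : (q @` Gs) 1%g.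
  by exists 1%g; [exact: (fisubgroupP Gs).1|exact: cryst_q1 hG].
have := PM _ _ v Q1 Q1; rewrite mulg1 /omega /nu mulg1 gam1 !mulg1 invg1.
rewrite (char1 hG) rmorph1 scale1r => /esym; exact: (unitary_op_inj (Pu _ Q1)).
Qed.

Lemma generic_lattice k m v : N m -> sigma k m v = chi k m *: v.
Proof.
move=> Nm; rewrite (gen_sigma gen) ?q1//; last exact: GsN.
by rewrite generic_Phi1 /char_star q1// gam1 invg1 mul1g (gen_lam1 gen) mulr1.
Qed.

(** The scalar [laml 1] acts as the identity because [sigmal], being a representation, is the
    identity at 1. *)
Lemma generic_limit_lattice m v : N m -> sigmal m v = chil m *: v.
Proof.
move=> Nm; have N1 := (cryst_sub hG).1.
have sE m' : N m' -> sigmal m' v = chil m' *: (laml 1%g *: v).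
  move=> Nm'; rewrite (gen_sigmal gen) ?q1//; last exact: GsN.
  by rewrite generic_Phi1 /char_star q1// gam1 invg1 mul1g scalerA.
have := sE _ N1; rewrite urep1 ?(char1 hG) ?scale1r; last exact: fisubgroupP.
by move=> {2}->; exact: sE.
Qed.

Let star_N x : N ((gam (q x))^-1 * x)%g.
Proof.
apply/(cryst_memN hG).
by rewrite (cryst_morph hG) (cryst_qV hG) gamK mulVg.
Qed.

(** On Gs the operators of [sigma k] and of [Phi] differ by nonzero scalars, so invariant subspaces
    agree. *)
Lemma generic_irr k : irreducible Gs (sigma k).
Proof.
have [nz Phi_irr] := gen_Phi_irr gen; split=> // W Wc Winv; apply: Phi_irr =>
  // d v.
move=> [x Gx <-] Wv; have sW := closed_lin_subspace Wc.
set c := char_star q gam (chi k) x * lam k (q x).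
have c0 : c != 0.
  have lx : `|lam k (q x)| = 1 by apply: (gen_lam_norm gen); exists x.
  by rewrite -normr_eq0 normrM /char_star character_norm// lx mulr1 oner_eq0.
rewrite -[Phi _ _]scale1r -(mulVf c0) -scalerA -(gen_sigma gen)//.
by apply: lin_subspaceZ => //; exact: Winv.
Qed.

Lemma generic_cvg x v : fisubgroup_set Gs x ->
  hcvg (fun k => sigma k x v) (sigmal x v).
Proof.
move=> Gx; rewrite (gen_sigmal gen)//.
rewrite (_ : (fun k => _) = fun k =>
    (char_star q gam (chi k) x * lam k (q x)) *: Phi (q x) v); last first.
  by apply/funext => k; rewrite (gen_sigma gen).
have lamc := gen_lam_cvg gen (ex_intro2 _ _ x Gx erefl).
apply: hcvg_scale; exact: (cvgM (gen_cvg gen (star_N x)) lamc).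
Qed.

(** At a point x the product acts by a scalar. Its factor indexed by d = q x compares chi_k and chi
    at the same conjugate of n_d and is small for large k; all other factors have modulus at most
    1. *)
Lemma generic_shifts l (c : R) :
  map fst l = enum D -> (forall p, p \in l -> N p.2) -> 0 < c ->
  exists M, forall k (f : induced_hilbert (sigma k)), (M <= k)%N ->
    hnorm (shift_op (induced_rep (sigma k))
      (weight_shifts (orbit_char gam chil) l) f) <= c * hnorm f.
Proof.
move=> lD lN c0; have lN' p : p \in weight_shifts (orbit_char gam chil) l ->
  N p.1.
  by move=> /mapP[p' p'l ->]; exact: lN.
(* [M] does not depend on x, because D and [l] are finite and only finitely many elements of N are
   tested. *)
have /filter_forall[M _ Mc] : forall d : D, \forall k \near \oo,
    forall p, p \in l -> p.1 = d ->
    normc (chi k ((gam d)^-1 * p.2 * gam d)%g - orbit_char gam chil d p.2) < c.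
  move=> d; pose P (p : D * G) k := p.1 = d ->
    normc (chi k ((gam d)^-1 * p.2 * gam d)%g - orbit_char gam chil d p.2) < c.
  suff : forall s : seq (D * G), (forall p, p \in s -> N p.2) ->
    \forall k \near \oo, forall p, p \in s -> P p k by move/(_ l lN).
  elim=> [|p s IHs] sN; first exact: nearW.
  have Np : N p.2 by apply: sN; rewrite mem_head.
  have := cvg_normc (gen_cvg gen (cryst_normal hG (gam d) Np)) c0.
  have /IHs : forall p, p \in s -> N p.2 by move=> p' p's; apply: sN;
    rewrite inE p's orbT.
  apply: filterS2 => k ks kp p'; rewrite inE => /orP[/eqP ->|/ks //].
  by move=> _; exact: kp.
exists M => k f /Mc Mk; apply: induced_norm_scale; first exact: ltW.
move=> x; rewrite (shift_op_induced _ _ (gen_stab gen k)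
  (generic_lattice k) lN').
rewrite hnormZ ler_wpM2r ?hnorm_ge0// big_map.
have : q x \in map fst l by rewrite lD mem_enum.
move=> /mapP[p pl xp]; rewrite (big_rem p pl)/= normcM.
have half1 (a b : R[i]) : normc a = 1 -> normc b = 1 ->
  normc (2^-1 * (a - b)) <= 1.
  move=> a1 b1; rewrite normcM normc_half ler_pdivrMl// mulr1.
  by apply: le_trans (le_normcD _ _) _; rewrite normcN a1 b1.
apply: (@le_trans _ _ (c * 1)); last by rewrite mulr1.
apply: ler_pM; rewrite ?normc_ge0//.
  rewrite normcM normc_half ler_pdivrMl//.
  rewrite (cryst_conj_eq hG (lN _ pl) (y := gam (q x))) ?gamK// xp.
  by apply: le_trans (ltW (Mk _ p pl erefl)) _; rewrite ler_peMl ?ler1n// ltW.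
rewrite big_seq; elim/big_ind : _ => [|a b a1 b1|p' /mem_rem p'l].
- by rewrite normc1.
- by rewrite normcM mulr_ile1 ?normc_ge0.
- apply: half1; last by rewrite (orbit_char_norm hG)//; exact: lN.
  by apply: char_normc; apply: cryst_normal hG _ _ _; exact: lN.
Qed.

End GenericSequence.

Theorem theorem4p24 (R : realType) (r : nat) (G : groupType) (N : set G)
    (D : finGroupType) (q : G -> D) (hG : crystallographic r N q)
    (gam : D -> G) (gamK : forall d, q (gam d) = d) (gam1 : gam 1%g = 1%g)
    (chi : nat -> character R N) (chil : character R N)
    (Gs : fisubgroup G) (n : nat) (H : hilbert R)
    (sigma : nat -> urep Gs H) (sigmal : urep Gs H)
    (hgen : generic_sequence q gam chi chil n sigma sigmal) :
  exists irr_sigma :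
      forall k, irreducible [set: G] (induced_rep (sigma k)),
    let ind_sigma k := iclass (Irrep (irr_sigma k)) in
    (exists S : dual R (stabilizer hG chil) -> Prop,
      [/\ exists x, S x,
          forall x, S x -> dual_over chil x
        & forall rho : irrep R (stabilizer hG chil), S (iclass rho) ->
            exists irr_rho : irreducible [set: G] (induced_rep rho),
              dual_cvg ind_sigma (iclass (Irrep irr_rho))]) /\
    (forall pi : irrep R [set: G], dual_cvg ind_sigma (iclass pi) ->
       exists rho : irrep R (stabilizer hG chil),
         dual_over chil (iclass rho) /\
         unitarily_equivalent pi (induced_rep rho)).
Proof.
have [lam [laml [Phi gen]]] := hgen.
have irr_sigma k : irreducible [set: G] (induced_rep (sigma k)).
  have sN m v : N m -> sigma k m v = chi k m *: v by
    exact: (generic_lattice hG gam1 gen).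
  have sirr : irreducible Gs (sigma k) by exact: (generic_irr hG gamK gen).
  exact: (induced_irreducible hG (gen_stab gen k) sN sirr).
exists irr_sigma => ind_sigma.
have chiK : char_stab chil = stabilizer hG chil by [].
have over (pi : irrep R [set: G])
  (w : exists2 v, weight_space chil pi v & v != 0) :
    dual_over chil (iclass (Irrep (weight_rep_irr hG chiK gamK
      (irrep_irr pi) w))).
  exists (Irrep (weight_rep_irr hG chiK gamK (irrep_irr pi) w)).
    exact: unitarily_equivalent_refl.
  have [m m0 mP] := weight_rep_dim hG chiK gamK (irrep_irr pi) w.
  by exists m; split=> // m' v; exact: weight_repN.
split.
  have [h h0] := (generic_irr hG gamK gen 0).1.
  (* A vector of weight chi in ind sigma, which need not be irreducible; [sub_irrep] then passes to
     an irreducible part. *)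
  pose v := ind_delta sigmal h.
  have v0 : v != 0.
    by apply: contraNneq h0 => v0; rewrite -(ind_delta1 sigmal h) -/v v0.
  have NGs : N `<=` Gs by rewrite -(gen_stab gen 0);
    exact: char_stab_lattice hG _.
  have Ev : weight_space chil (induced_rep sigmal) v.
    move=> m Nm; rewrite [LHS]translate_delta; last exact: NGs.
    rewrite (generic_limit_lattice hG gam1 gen)//.
    have := ind_delta_lin sigmal (chil m) h 0.
    rewrite addr0 => ->; rewrite [X in _ + X](_ : _ = 0) ?addr0//.
    by have := ind_delta_lin sigmal (-1) 0 0;
      rewrite !scaleN1r oppr0 addr0 addNr.
  have [pi0 [ker_pi0 w]] := sub_irrep hG gamK Ev v0.
  pose rho0 := Irrep (weight_rep_irr hG chiK gamK (irrep_irr pi0) w).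
  (* A single class suffices. Equality of classes only gives that [rho] is equivalent to [rho0], so
     the action of N and the kernel are transported along this equivalence. *)
  exists (fun x => x = iclass rho0); split.
  - by exists (iclass rho0).
  - by move=> x ->; exact: over.
  - move=> rho rhoE.
    have rho_rho0 : unitarily_equivalent rho rho0.
      have : dual_class (iclass rho) rho0.
        by rewrite rhoE; exact: unitarily_equivalent_refl.
      exact.
    have rhoN m u : N m -> rho m u = chil m *: u.
      move=> Nm; have [T uT Trho] := rho_rho0; apply: (unitary_op_inj uT).
      rewrite Trho; last exact: char_stab_lattice hG _ _ Nm.
      by rewrite unitary_opZ//; exact: weight_repN.
    exists (induced_irreducible hG chiK rhoN (irrep_irr rho)).
    apply: dual_cvgI => A Ainf a aA /=.
    have pi0_rho : unitarily_equivalent pi0 (induced_rep rho).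
      apply: unitarily_equivalent_trans (induced_rep_equiv _).
        exact: (mackey_equiv hG chiK gamK (irrep_irr pi0) w).
      exact: unitarily_equivalent_sym.
    rewrite -(rep_kernel_equiv pi0_rho); apply: ker_pi0.
    apply: (rep_kernel_limit (fun x v =>
      generic_cvg hG gamK gen v (x := x)) Ainf) => k Ak.
    by have := aA k Ak; rewrite dual_kernel_iclass.
move=> pi pi_cvg.
have w : exists2 v, weight_space chil pi v & v != 0.
  apply: (weight_from_shifts hG) (irrep_irr pi).1 _ => l lD lN.
  apply: (dual_cvg_shift_op pi_cvg) => [p /mapP[p' p'l ->] /=|c c0].
    by rewrite (orbit_char_norm hG)//; exact: lN.
  exact: (generic_shifts hG gamK gam1 gen lD lN c0).
exists (Irrep (weight_rep_irr hG chiK gamK (irrep_irr pi) w)); split;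
  first exact: over.
exact: (mackey_equiv hG chiK gamK (irrep_irr pi) w).
Qed.
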